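(* Let $m=(m_0,m_1,\dots)$ be a bounded sequence of integers with $m_k\ge 2$ for all $k$, let $G_m$ be the associated bounded Vilenkin group, and let $1/2<p<\infty$. Then the maximal operator $R^{*}$ of the Riesz logarithmic means is bounded from the Hardy space $H_p(G_m)$ to the space $L_p(G_m)$; that is, there is a constant $c_p>0$ (depending only on $p$ and $m$) such that $$\|R^{*}f\|_{p}\le c_p\,\|f\|_{H_p}\qquad\text{for every martingale } f\in H_p(G_m).$$
   Context: Notation: $\mathbb N_+=\{1,2,\dots\}$, $\mathbb N=\mathbb N_+\cup\{0\}$. Let $m=(m_0,m_1,\dots)$ be a sequence of integers $m_k\ge 2$ with $\sup_k m_k<\infty$. Let $Z_{m_k}=\{0,1,\dots,m_k-1\}$ be the additive group of integers modulo $m_k$ with the discrete topology. The (bounded) Vilenkin group $G_m$ is the complete direct product of the groups $Z_{m_k}$, with the product topology; its elements are sequences $x=(x_0,x_1,\dots)$ with $x_k\in Z_{m_k}$. The measure $\mu$ is the product of the measures $\mu_k(\{j\})=1/m_k$ ($j\in Z_{m_k}$), i.e. the Haar measure on $G_m$ with $\mu(G_m)=1$. Put $I_0(x)=G_m$ and $I_n(x)=\{y\in G_m: y_0=x_0,\dots,y_{n-1}=x_{n-1}\}$ for $n\in\mathbb N_+$. Put $M_0=1$, $M_{k+1}=m_kM_k$. Each $n\in\mathbb N$ is written uniquely as $n=\sum_{j\ge 0}n_jM_j$ with $n_j\in Z_{m_j}$, only finitely many $n_j$ nonzero. The generalized Rademacher functions are $r_k(x)=\exp(2\pi i x_k/m_k)$,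 and the Vilenkin system is $\psi_n(x)=\prod_{k\ge 0}r_k(x)^{n_k}$, $n\in\mathbb N$. For $0<p<\infty$, $\|g\|_p=\left(\int_{G_m}|g|^p\,d\mu\right)^{1/p}$ is the (quasi)norm of $L_p(G_m)$. Let $\mathcal F_n$ be the $\sigma$-algebra generated by $\{I_n(x):x\in G_m\}$. A martingale $f=(f^{(n)},n\in\mathbb N)$ is a martingale with respect to $(\mathcal F_n)_{n\in\mathbb N}$ and $\mu$. Its maximal function is $f^{*}=\sup_{n\in\mathbb N}|f^{(n)}|$. The martingale Hardy space $H_p(G_m)$ consists of all martingales $f$ with $\|f\|_{H_p}:=\|f^{*}\|_{p}<\infty$. The Vilenkin-Fourier coefficients of a martingale $f$ are $\widehat f(i)=\lim_{k\to\infty}\int_{G_m}f^{(k)}\overline{\psi_i}\,d\mu$. The partial sums are $S_nf=\sum_{k=0}^{n-1}\widehat f(k)\psi_k$ for $n\in\mathbb N_+$, and $S_0f=0$. The Riesz logarithmic means are $R_nf(x)=\frac1{l_n}\sum_{k=1}^{n}\frac{S_kf(x)}{k}$, where $l_n=\sum_{k=1}^{n}\frac1k$ ($n\in\mathbb N_+$), and the maximal operator is $R^{*}f(x)=\sup_{n\in\mathbb N_+}|R_nf(x)|$. *)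

(* Defs.v *)
From HB Require Import structures.
From mathcomp Require Import all_boot all_order all_algebra.
From mathcomp Require Import all_classical all_reals all_analysis.
From mathcomp Require Import measurable_realfun complex.
From mathcomp Require Import zify.

Set Implicit Arguments.
Unset Strict Implicit.
Unset Printing Implicit Defensive.

Import Order.TTheory GRing.Theory Num.Theory.
Import numFieldNormedType.Exports.
Import ComplexField.

Local Open Scope classical_set_scope.
Local Open Scope ring_scope.
Local Open Scope complex_scope.

(* For m k >= 2, 'Z_(m k) is the group of integers modulo m k, carried by
   {0, ..., m k - 1}. *)
Definition vilenkin (m : nat -> nat) : Type := forall k, 'Z_(m k).

HB.instance Definition _ m := Choice.copy (vilenkin m) (forall k, 'Z_(m k)).
HB.instance Definition _ m :=
  isPointed.Build (vilenkin m) (fun k => 0 : 'Z_(m k)).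

Definition I_ (m : nat -> nat) (n : nat) (x : vilenkin m) : set (vilenkin m) :=
  [set y | forall k, (k < n)%N -> y k = x k].

Definition cylinders (m : nat -> nat) : set (set (vilenkin m)) :=
  [set A | exists n x, A = I_ n x].

(* The sets I_ n x form a countable base of the product topology, so the
   sigma-algebra they generate is both the Borel and the product one. *)
HB.instance Definition _ m :=
  Measurable.copy (vilenkin m) (g_sigma_algebraType (@cylinders m)).

Definition M_ (m : nat -> nat) (n : nat) : nat :=
  (\prod_(k < n) m k)%N.

Definition digit (m : nat -> nat) (n j : nat) : nat :=
  ((n %/ M_ m j) %% m j)%N.

Section Digits.
Variable m : nat -> nat.
Hypothesis m_ge2 : forall k, (2 <= m k)%N.

Lemma M_S n : M_ m n.+1 = (M_ m n * m n)%N.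
Proof. by rewrite /M_ big_ord_recr. Qed.

Lemma M_gt n : (n < M_ m n)%N.
Proof.
elim: n => [|n IH]; first by rewrite /M_ big_ord0.
by rewrite M_S; have := m_ge2 n; nia.
Qed.

Lemma digit_lt n j : (digit m n j < m j)%N.
Proof. by rewrite ltn_mod; have := m_ge2 j; lia. Qed.

Lemma digit_expansion N n : (n < M_ m N)%N ->
  n = (\sum_(j < N) digit m n j * M_ m j)%N.
Proof.
move=> nM.
suff H K : (n %% M_ m K)%N = (\sum_(j < K) digit m n j * M_ m j)%N.
  by rewrite -H modn_small.
elim: K => [|K IH]; first by rewrite big_ord0 /M_ big_ord0 modn1.
rewrite big_ord_recr /= -IH M_S.
rewrite /digit {1}(divn_eq n (M_ m K)).
have MK : (0 < M_ m K)%N by have := M_gt K; lia.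
set q := (n %/ M_ m K)%N; set r := (n %% M_ m K)%N.
have rM : (r < M_ m K)%N by rewrite ltn_mod.
have mK : (0 < m K)%N by have := m_ge2 K; lia.
have qm : (q %% m K < m K)%N by rewrite ltn_mod.
rewrite {1}(divn_eq q (m K)) mulnDl -mulnA [(m K * _)%N]mulnC -addnA modnMDl.
rewrite modn_small; first by rewrite addnC.
nia.
Qed.

Lemma digit_eq0 n j : (n <= j)%N -> digit m n j = 0%N.
Proof.
by move=> nj; rewrite /digit divn_small ?mod0n//; have := M_gt j; lia.
Qed.

End Digits.

Section Vilenkin.
Variables (R : realType) (m : nat -> nat).
Local Notation G := (vilenkin m).

Definition coord_measure (k : nat) (A : {set 'Z_(m k)}) : R :=
  \sum_(j in A) (m k)%:R^-1.

Definition is_product_measure (mu : set G -> \bar R) : Prop :=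
  forall (n : nat) (A : forall k, {set 'Z_(m k)}),
    mu [set x | forall k, (k < n)%N -> x k \in A k] =
    (\prod_(k < n) coord_measure (A k))%:E.

Definition rademacher (k : nat) (x : G) : R[i] :=
  let t := 2 * pi * (x k : nat)%:R / (m k)%:R in cos t +i* sin t.

(* When all m k >= 2, n < M_ m n, so digit m n k = 0 for k >= n and the
   omitted factors are 1. *)
Definition psi (n : nat) (x : G) : R[i] :=
  \prod_(k < n) rademacher k x ^+ digit m n k.

Definition F_ (n : nat) : set (set G) := <<s range (@I_ m n) >>.

Definition adapted_to (F : set (set G)) (g : G -> R[i]) : Prop :=
  forall B : set R, measurable B ->
    F ((fun x => complex.Re (g x)) @^-1` B) /\
    F ((fun x => complex.Im (g x)) @^-1` B).

Variable mu : probability G R.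

Definition cintegrable (g : G -> R[i]) : Prop :=
  mu.-integrable setT (EFin \o (fun x => complex.Re (g x))) /\
  mu.-integrable setT (EFin \o (fun x => complex.Im (g x))).

Definition cintegral (A : set G) (g : G -> R[i]) : R[i] :=
  Rintegral mu A (fun x => complex.Re (g x)) +i*
  Rintegral mu A (fun x => complex.Im (g x)).

Record martingale (f : nat -> G -> R[i]) : Prop := Martingale {
  martingale_adapted : forall n, adapted_to (F_ n) (f n) ;
  martingale_integrable : forall n, cintegrable (f n) ;
  martingale_cond : forall n k (A : set G), (n <= k)%N -> F_ n A ->
    cintegral A (f k) = cintegral A (f n) }.

Definition maximal_function (f : nat -> G -> R[i]) (x : G) : \bar R :=
  ereal_sup [set (Normc.normc (f n x))%:E | n in [set: nat]].

Definition hardy_norm (p : R) (f : nat -> G -> R[i]) : \bar R :=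
  'N[mu]_p%:E [maximal_function f].

Definition hardy_space (p : R) (f : nat -> G -> R[i]) : Prop :=
  martingale f /\ (hardy_norm p f < +oo)%E.

(* The limit in R[i] is taken componentwise. *)
Definition fourier_coef (f : nat -> G -> R[i]) (i : nat) : R[i] :=
  let c k := cintegral setT (fun x => f k x * (psi i x)^*) in
  limn (fun k => complex.Re (c k)) +i* limn (fun k => complex.Im (c k)).

Definition partial_sum (f : nat -> G -> R[i]) (n : nat) (x : G) : R[i] :=
  \sum_(k < n) fourier_coef f k * psi k x.

Definition log_weight (n : nat) : R := \sum_(1 <= k < n.+1) k%:R^-1.

Definition riesz_mean (f : nat -> G -> R[i]) (n : nat) (x : G) : R[i] :=
  (log_weight n)^-1%:C * \sum_(1 <= k < n.+1) partial_sum f k x / k%:R.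

Definition riesz_maximal (f : nat -> G -> R[i]) (x : G) : \bar R :=
  ereal_sup [set (Normc.normc (riesz_mean f n x))%:E | n in [set n | (0 < n)%N]].

End Vilenkin.

(* A measure satisfying is_product_measure exists: the image of the uniform
   probability on [0, 1] under the mixed-radix digit map dg. *)
Module ProductMeasure.
Section ProductMeasure.
Variables (R : realType) (m : nat -> nat).
Hypothesis m_ge2 : forall k, (2 <= m k)%N.
Local Notation G := (vilenkin m).

Definition dg (t : measurableTypeR R) : G := fun k => inZp (Num.truncn (t * (M_ m k.+1)%:R)).

Lemma Zp_val k (i : nat) : (inZp i : 'Z_(m k)) = (i %% m k)%N :> nat.
Proof. by rewrite /= Zp_cast. Qed.

Lemma truncn_div (y : R) (d : nat) : 0 <= y -> (0 < d)%N ->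
  (Num.truncn (y * d%:R) %/ d)%N = Num.truncn y.
Proof.
move=> y0 d0; apply/esym/eqP; rewrite truncn_eq//.
have dR : 0 < d%:R :> R by rewrite ltr0n.
have /truncn_itv/andP[h1 h2] : 0 <= y * d%:R by rewrite mulr_ge0// ltW.
set N := Num.truncn _ in h1 h2 *.
have e := divn_eq N d; have r := ltn_pmod N d0.
apply/andP; split.
  rewrite -(ler_pM2r dR) -natrM; apply: le_trans h1; rewrite ler_nat.
  by rewrite [leqRHS]e leq_addr.
rewrite -(ltr_pM2r dR) -natrM; apply: (lt_le_trans h2); rewrite ler_nat.
by rewrite {1}e mulSn; lia.
Qed.

Fixpoint code (x : G) n : nat :=
  if n is k.+1 then (code x k * m k + x k)%N else 0%N.

Lemma xlt (x : G) k : (x k < m k)%N.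
Proof. by rewrite -[X in (_ < X)%N](Zp_cast (m_ge2 k)) ltn_ord. Qed.

Lemma code_lt (x : G) n : (code x n < M_ m n)%N.
Proof.
elim: n => [|n IH] /=; first by rewrite /M_ big_ord0.
by rewrite M_S; have := xlt x n; nia.
Qed.

Lemma dgP (x : G) n (t : measurableTypeR R) : 0 <= t < 1 ->
  I_ n x (dg t) <-> Num.truncn (t * (M_ m n)%:R) = code x n.
Proof.
move=> /andP[t0 t1]; elim: n => [|n IH].
  rewrite /M_ big_ord0 mulr1 /=; split => // _.
  by apply/truncn0Pn; rewrite -ltNge.
have mn : (0 < m n)%N by have := m_ge2 n; lia.
have -> : I_ n.+1 x (dg t) <-> I_ n x (dg t) /\ dg t n = x n.
  split=> [h|[h1 h2] k]; first by split=> [k kn|]; apply: h; lia.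
  by rewrite ltnS leq_eqVlt => /predU1P[->//|]; exact: h1.
rewrite IH /= M_S.
have <- : (Num.truncn (t * (M_ m n * m n)%:R) %/ m n)%N =
         Num.truncn (t * (M_ m n)%:R).
  by rewrite natrM mulrA truncn_div// mulr_ge0.
have -> : dg t n = x n <->
    (Num.truncn (t * (M_ m n * m n)%:R) %% m n)%N = x n.
  split=> [<-|h]; first by rewrite -Zp_val -M_S.
  by apply: val_inj; rewrite -[RHS]h -Zp_val -M_S.
set N := Num.truncn _; split=> [[<- <-]|e]; first by rewrite -divn_eq.
have xm := xlt x n.
by split; rewrite e ?modnMDl ?divnMDl// ?divn_small ?modn_small// addn0.
Qed.

Lemma measurable_truncn_mod (s : nat) k (c : 'Z_(m k)) :
  measurable [set t : R | inZp (Num.truncn (t * s%:R)) = c].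
Proof.
suff mt i : measurable [set t : R | Num.truncn (t * s%:R) = i].
  rewrite (_ : [set _ | _] = \bigcup_(i in [set i : nat | inZp i = c])
      [set t : R | Num.truncn (t * s%:R) = i]).
    by apply: bigcup_measurable => i _; exact: mt.
  apply/seteqP; split=> [t /= h|t [i /= ic ti]]; last by rewrite /= ti.
  by exists (Num.truncn (t * s%:R)).
have mle j : measurable [set t : R | (Num.truncn (t * s%:R) <= j)%N].
  rewrite (_ : [set _ | _] = [set t : R | t * s%:R < j.+1%:R]); last first.
    by apply/seteqP; split => t /=; rewrite truncn_le_nat.
  rewrite -[X in measurable X]setTI.
  have mf : measurable_fun setT (fun t : R => t * s%:R).
    exact: mulrr_measurable.
  have := mf measurableT `]-oo, j.+1%:R[%classic (measurable_itv _).
  by congr measurable; apply/seteqP; split => t /=; rewrite in_itv.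
case: i => [|i].
  by have := mle 0%N; congr measurable; apply/seteqP; split => t /=; lia.
have := measurableD (mle i.+1) (mle i); congr measurable.
by apply/seteqP; split => t /=; lia.
Qed.

Lemma measurable_dg : measurable_fun setT dg.
Proof.
apply: (measurability (@cylinders m)) => // _ [_ [n [x ->]] <-].
rewrite setTI (_ : _ @^-1` _ = \bigcap_(k in [set k | (k < n)%N])
    [set t : R | inZp (Num.truncn (t * (M_ m k.+1)%:R)) = x k]); last first.
  by apply/seteqP; split => t /= h k; exact: h.
by apply: bigcap_measurableType => k _; exact: measurable_truncn_mod.
Qed.


HB.instance Definition _ := isMeasurableFun.Build _ _ (measurableTypeR R) G dg measurable_dg.

Lemma measurable_I n (x : G) : measurable (I_ n x).
Proof. by apply: sub_sigma_algebra; exists n, x. Qed.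

Definition nu : probability G R := distribution (uniform_prob (@ltr01 R)) dg.

Lemma nu_I n (x : G) : nu (I_ n x) = ((M_ m n)%:R^-1)%:E.
Proof.
rewrite /nu /= /distribution /pushforward /uniform_prob.
have M0 : 0 < (M_ m n)%:R :> R by rewrite ltr0n; have := M_gt m_ge2 n; lia.
pose a : R := (code x n)%:R / (M_ m n)%:R.
pose b : R := (code x n).+1%:R / (M_ m n)%:R.
have ab : a < b by rewrite ltr_pM2r ?invr_gt0// ltr_nat.
have a0 : 0 <= a by rewrite divr_ge0.
have b1 : b <= 1 by rewrite ler_pdivrMr// mul1r ler_nat code_lt.
have mI := measurable_dg measurableT (measurable_I n x).
rewrite setTI in mI.
have pw (t : R) : 0 <= t < 1 -> (dg @^-1` I_ n x) t <-> t \in `[a, b[.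
  move=> t01; apply: (iff_trans (dgP x n t01)); rewrite in_itv /=.
  have t0 : 0 <= t * (M_ m n)%:R by rewrite mulr_ge0//; case/andP: t01.
  by rewrite ler_pdivrMr// ltr_pdivlMr// -truncn_eq//; split=> /eqP.
transitivity (\int[@lebesgue_measure R]_(x in `[a, b[) (1%:E))%E; last first.
  rewrite integral_cst//= mul1e lebesgue_measure_itv/= lte_fin ab.
  by rewrite -EFinB /a /b -mulrBl -[_.+1]addn1 natrD addrAC subrr add0r mul1r.
rewrite integral_mkcond [RHS]integral_mkcond.
apply: ae_eq_integral => //.
- apply/(measurable_restrictT _ _).1 => //.
  apply/measurable_EFinP/measurable_funTS; exact: measurable_uniform_pdf.
- by apply/(measurable_restrictT _ _).1.
- exists [set 1]; split; [exact: measurable_set1|exact: lebesgue_measure_set1|].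
  move=> t /= H; apply: contrapT => t1; apply: H => _.
  rewrite !patchE /uniform_pdf subr0 invr1.
  case: (boolP (0 <= t < 1)) => t01.
    have e : (t \in dg @^-1` I_ n x) = (t \in `[a, b[%classic).
      by apply/idP/idP; rewrite !inE /= => /(pw _ t01).
    rewrite e; case: ifP => // _; case/andP: t01 => t0 t1'.
    by rewrite t0 ltW.
  have -> : (0 <= t <= 1) = false.
    by apply/negbTE; apply: contra t01 => /andP[-> t1']; rewrite lt_neqAle t1' (introN eqP).
  rewrite (_ : (t \in `[a, b[%classic) = false) ?if_same//.
  apply/negbTE; apply: contra t01; rewrite inE /= in_itv /= => /andP[h1 h2].
  by rewrite (le_trans a0 h1) (lt_le_trans h2 b1).
Qed.

Let mixed n j (y : G) (A : forall k, {set 'Z_(m k)}) : set G :=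
  [set x | (forall k, (k < n)%N -> x k = y k) /\
           (forall k, (n <= k < n + j)%N -> x k \in A k)].

Lemma mixedE j : forall n y A, measurable (mixed n j y A) /\
  nu (mixed n j y A) =
  ((M_ m n)%:R^-1 * \prod_(n <= k < n + j) (coord_measure R (A k)))%:E.
Proof.
elim: j => [|j IH] n y A.
  have -> : mixed n 0 y A = I_ n y.
    by apply/seteqP; split=> [x []//|x h]; split=> // k; lia.
  by split; [exact: measurable_I | rewrite nu_I addn0 big_geq// mulr1].
have mn : (M_ m n)%:R != 0 :> R by rewrite pnatr_eq0; have := M_gt m_ge2 n; lia.
have mN : (m n)%:R != 0 :> R by rewrite pnatr_eq0; have := m_ge2 n; lia.
pose u (c : 'Z_(m n)) : G := dfwith y n c.
have -> : mixed n j.+1 y A =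
    \bigcup_(c in [set c | c \in A n]) mixed n.+1 j (u c) A.
  apply/seteqP; split=> [x [h1 h2]|x [c /= cA [h1 h2]]].
    exists (x n) => /=; first by apply: h2; lia.
    split=> k kn; last by apply: h2; lia.
    rewrite /u; have [->|kn'] := eqVneq k n; first by rewrite dfwithin.
    by rewrite dfwithout 1?eq_sym//; apply: h1; lia.
  split=> k kn.
    by rewrite h1; [rewrite /u dfwithout//; lia|lia].
  have [->|kn'] := eqVneq k n; last by apply: h2; lia.
  by rewrite h1// /u dfwithin.
split.
  apply: fin_bigcup_measurable; first exact: finite_finset.
  by move=> c _; have [] := IH n.+1 (u c) A.
rewrite measure_fin_bigcup//; first last.
- by move=> c _; have [] := IH n.+1 (u c) A.
- move=> c d _ _ [x [[h1 _] [h2 _]]].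
  by have := h1 n (leqnn _); rewrite (h2 n (leqnn _)) /u !dfwithin.
rewrite (_ : [set c | c \in A n] = [set` enum (A n)]); last first.
  by apply/seteqP; split => c /=; rewrite mem_enum.
rewrite -fsbig_seq ?enum_uniq// big_enum /=.
rewrite (eq_bigr _ (fun c _ => (IH n.+1 (u c) A).2)).
rewrite sumEFin; congr EFin.
rewrite addSnnS [in RHS]big_ltn; last by lia.
rewrite M_S natrM invfM /coord_measure.
by rewrite mulrA mulr_sumr mulr_suml.
Qed.

Lemma product_measure_exists : exists mu : probability G R, is_product_measure mu.
Proof.
exists nu => n A.
have [_] := mixedE n 0 point A.
rewrite /M_ big_ord0 invr1 mul1r add0n big_mkord => <-.
congr (nu _); apply/seteqP; split=> x /= h.
  by split=> // k /andP[_]; exact: h.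
by case: h => _ h k kn; exact: h.
Qed.

End ProductMeasure.
End ProductMeasure.

(* Main.v *)
Require Import Defs.
From mathcomp Require Import all_boot all_order all_algebra.
From mathcomp Require Import all_classical all_reals all_analysis.
From mathcomp Require Import measurable_realfun complex zify ring lra.

Set Implicit Arguments.
Unset Strict Implicit.
Unset Printing Implicit Defensive.

Import Order.TTheory GRing.Theory Num.Theory.
Import numFieldNormedType.Exports.

Local Open Scope classical_set_scope.
Local Open Scope ring_scope.

(** Abel summation exhibits the Riesz mean of index n as an average of the Fejer
    means of index at most n (log_mean_le), so it suffices to bound the maximal
    function of the Fejer means.  This is done directly for all p > 1/2 at once,
    without atoms and without interpolation.

    Kernel.  For n < M_N the n-th Fejer mean of f at x is an average of f^(N)(y)
    against the kernel K_n(x - y).  If t < A are the first two coordinates at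
    which x and y differ, then n |K_n(x - y)| <= M_{t+1} M_{A+1}, because the
    characters cancel over full blocks of length M_{t+1} and the Dirichlet
    kernels over full blocks of length M_{A+1} (norm_fejer_sum2).  When n is
    comparable with M_N this gives, up to a constant,
      |sigma_n f(x)| <= sum over t <= A <= N of (M_t / M_N) Q_{A,t} |f^(N)| (x),
    where Q_{A,t} g (x) is essentially the mean of g over the points that agree
    with x in the first A coordinates except the t-th one (smear, scale_sum,
    sum_partial_sum_le).

    Powers.  For p <= 1 the p-th power can be taken inside Q_{A,t} at the cost of
    a factor (M_N / M_A)^(1-p), because f^(N) is constant on cylinders of level N.
    The resulting weight (M_t / M_A)^p (M_A / M_N)^(2p-1) decays geometrically in
    N - A and A - t precisely because p > 1/2.  For p >= 1 convexity is enough.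
    In both cases |sigma_n f|^p is bounded by a geometrically weighted sum of
    Q_{A,t} |f^(N)|^p (scale_sum_pow).

    Supremum.  Let F_N be the maximum of |f^(k)|^p over k <= N.  It is
    nondecreasing in N, and F_N = F_t + sum of the increments d_K, t < K <= N.
    Since t <= A, the operator Q_{A,t} multiplies F_t by a bounded factor, so this
    part is bounded by the maximal function for all N simultaneously.  The
    increments are simply summed over N: Q_{A,t} preserves integrals up to a
    bounded factor, the geometric weights make the sum over N, A and t converge
    for each K, and the integrals of the d_K telescope
    (geo_sum_le_majorant, sum_majorant).

    Everything up to level L depends on L coordinates only, so these estimates
    are inequalities between finite sums; integrals of such functions are
    averages over the finite quotient (cylindrical_integral), and monotone
    convergence removes L (integral_sup_pow). *)

(** * Dirichlet and Fejer kernels as block sums of characters *)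

Section Kernel.
Variables (C : numDomainType) (m : nat -> nat).
Hypothesis m_ge2 : forall k, (2 <= m k)%N.
Local Notation M := (M_ m).

Lemma M_gt0 n : (0 < M n)%N.
Proof. by have := M_gt m_ge2 n; lia. Qed.

Lemma M_dvd i j : (i <= j)%N -> (M i %| M j)%N.
Proof.
move=> /subnKC <-; elim: (j - i)%N => [|d IH]; first by rewrite addn0.
by rewrite addnS M_S dvdn_mulr.
Qed.

Lemma M_le i j : (i <= j)%N -> (M i <= M j)%N.
Proof. by move=> /M_dvd; apply: dvdn_leq; exact: M_gt0. Qed.

Lemma digit_small n k : (n < M k)%N -> digit m n k = 0%N.
Proof. by move=> h; rewrite /digit divn_small ?mod0n. Qed.

(** Adding r < M A to a multiple of M A causes no carry: the two
    summands occupy disjoint digit positions. *)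
Lemma digit_block q r A k : (r < M A)%N ->
  digit m (q * M A + r) k = (digit m (q * M A) k + digit m r k)%N.
Proof.
move=> rA; have [Ak|kA] := leqP A k.
  rewrite (digit_small (leq_trans rA (M_le Ak))) addn0 /digit.
  have /dvdnP[c ->] := M_dvd Ak.
  by rewrite [(c * _)%N]mulnC !divnMA divnMDl ?M_gt0// (divn_small rA) addn0 mulnK ?M_gt0.
have /dvdnP[c ->] := M_dvd kA.
rewrite /digit M_S (_ : q * (c * (M k * m k)) = q * c * m k * M k)%N; last by lia.
by rewrite divnMDl ?M_gt0// mulnK ?M_gt0// modnMDl modnMl.
Qed.

Lemma digit_monomial v A k : (v < m A)%N ->
  digit m (v * M A) k = if k == A then v else 0%N.
Proof.
move=> vA; case: eqVneq => [->|kA].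
  by rewrite /digit mulnK ?M_gt0// modn_small.
have [Ak|{}kA] : (A < k)%N \/ (k < A)%N by lia.
  apply: digit_small; apply: leq_trans (M_le Ak).
  by rewrite M_S mulnC ltn_pmul2l ?M_gt0.
have /dvdnP[c ->] := M_dvd kA; rewrite /digit M_S.
have -> : (v * (c * (M k * m k)) = v * c * m k * M k)%N by lia.
by rewrite mulnK ?M_gt0// modnMl.
Qed.

Variable w : nat -> C.
Hypothesis w_root : forall k, w k ^+ m k = 1.

(** With w k the ratio of the k-th Rademacher functions at x and y, this is
    psi_n(x) times the conjugate of psi_n(y), that is psi_n(x - y).  Only the
    root-of-unity relation matters below, so w is left abstract. *)
Definition wchar n : C := \prod_(k < n) w k ^+ digit m n k.

Lemma wchar_widen K n : (n <= K)%N -> wchar n = \prod_(k < K) w k ^+ digit m n k.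
Proof.
move=> nK; rewrite /wchar.
rewrite (big_ord_widen K (fun k => w k ^+ digit m n k))// big_mkcond.
apply: eq_bigr => k _; case: ltnP => // nk.
by rewrite digit_eq0.
Qed.

Lemma wchar_block q r A : (r < M A)%N ->
  wchar (q * M A + r) = wchar (q * M A) * wchar r.
Proof.
move=> rA; rewrite [LHS]/wchar (wchar_widen (leq_addr r (q * M A)%N)).
rewrite (wchar_widen (leq_addl (q * M A)%N r)) -big_split.
by apply: eq_bigr => k _; rewrite digit_block// exprD.
Qed.

Lemma wchar_monomial v A : (v < m A)%N -> wchar (v * M A) = w A ^+ v.
Proof.
move=> vA; rewrite (@wchar_widen (v * M A + A.+1)) ?leq_addr//.
have AK : (A < v * M A + A.+1)%N by lia.
rewrite (bigD1 (Ordinal AK))//= big1 => [|k kA].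
  by rewrite mulr1 digit_monomial// eqxx.
rewrite digit_monomial// ifN ?expr0//.
Qed.

Lemma norm_w k : `|w k| = 1.
Proof.
apply/eqP; rewrite -(@eqrXn2 _ (m k)) ?ler01 ?normr_ge0//; last first.
  by have := m_ge2 k; lia.
by rewrite -normrX w_root normr1 expr1n.
Qed.

Lemma norm_wchar n : `|wchar n| = 1.
Proof.
by rewrite /wchar normr_prod big1// => k _; rewrite normrX norm_w expr1n.
Qed.

(** From scale M A on, a translation of the index by a full block acts on
    the sequence as multiplication by a unimodular character.  This is the one
    property of the characters that summation passes on: see modulated_psum. *)
Definition modulated (A : nat) (a : nat -> C) :=
  forall B q r, (A <= B)%N -> (r < M B)%N ->
    a (q * M B + r)%N = wchar (q * M B) * a r.

Lemma modulated_wchar : modulated 0 wchar.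
Proof. by move=> B q r _; exact: wchar_block. Qed.

Definition psum (a : nat -> C) n := \sum_(i < n) a i.

Lemma psum_block A a B q r : modulated A a -> (A <= B)%N -> (r <= M B)%N ->
  psum a (q * M B + r) = psum a (q * M B) + wchar (q * M B) * psum a r.
Proof.
move=> ma AB rB; rewrite /psum big_split_ord /= mulr_sumr; congr (_ + _).
by apply: eq_bigr => i _; rewrite (ma B)// (leq_trans (ltn_ord i)).
Qed.

Lemma root_sum_eq0 k : w k != 1 -> \sum_(u < m k) w k ^+ u = 0.
Proof.
move=> wk; apply: (mulfI (x := w k - 1)); first by rewrite subr_eq0.
by rewrite mulr0 -subrX1 w_root subrr.
Qed.

(** Summing a modulated sequence over a block of length M A.+1 runs through
    all powers of w A, and these cancel when w A is a nontrivial root of unity.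
    So partial sums vanish at multiples of M A.+1, and beyond that scale they
    are modulated in turn.  Applied once to the characters and once to the
    Dirichlet kernel, it explains both gains in norm_fejer_sum2. *)
Lemma modulated_psum A0 A a : (A0 <= A)%N -> modulated A0 a -> w A != 1 ->
  modulated A.+1 (psum a).
Proof.
move=> A0A ma wA.
have P0 : psum a 0 = 0 by rewrite /psum big_ord0.
(* One block of length M A.+1 consists of m A blocks of length M A, which
   differ by the successive powers of w A. *)
have PS : psum a (M A.+1) = 0.
  have H v : (v <= m A)%N ->
      psum a (v * M A) = (\sum_(u < v) w A ^+ u) * psum a (M A).
    elim: v => [|v IH] vm; first by rewrite mul0n P0 big_ord0 mul0r.
    rewrite mulSn addnC (psum_block _ ma)// IH ?(ltnW vm)// wchar_monomial//.
    by rewrite big_ord_recr /= mulrDl.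
  by rewrite M_S mulnC H// root_sum_eq0// mul0r.
have PqS q : psum a (q * M A.+1) = 0.
  elim: q => [|q IH]; first by rewrite mul0n P0.
  rewrite mulSn addnC (psum_block _ ma)//; last by lia.
  by rewrite IH PS mulr0 addr0.
move=> B q r AB rB; rewrite (psum_block _ ma) ?(ltnW rB)//; last by lia.
by have /dvdnP[c ->] := M_dvd AB; rewrite mulnA PqS add0r.
Qed.

Definition dirichlet := psum wchar.

(** The sum of the Dirichlet kernels of index below n, i.e. n - 1 times the
    Fejer kernel of index n - 1; the kernel of index 0 vanishes. *)
Definition fejer_sum := psum dirichlet.

Lemma norm_psum_le a b n : (forall i, `|a i| <= b%:R) -> `|psum a n| <= (n * b)%:R.
Proof.
move=> ab; apply: le_trans (ler_norm_sum _ _ _) _.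
apply: (@le_trans _ _ (\sum_(i < n) b%:R)); first by apply: ler_sum => i _.
by rewrite sumr_const card_ord natrM mulr_natl.
Qed.

(** By unimodularity only the last incomplete block contributes. *)
Lemma modulated_norm A a n : modulated A a -> `|a n| = `|a (n %% M A)%N|.
Proof.
move=> ma; rewrite {1}(divn_eq n (M A)) (ma A)// ?ltn_mod ?M_gt0//.
by rewrite normrM norm_wchar mul1r.
Qed.

Lemma norm_dirichlet_trivial n : `|dirichlet n| <= n%:R.
Proof.
by rewrite -[n in leRHS]muln1; apply: norm_psum_le => i; rewrite norm_wchar.
Qed.

Lemma norm_dirichlet t n : w t != 1 -> `|dirichlet n| <= (M t.+1)%:R.
Proof.
move=> wt; rewrite (modulated_norm n (modulated_psum (leq0n t) modulated_wchar wt)).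
apply: le_trans (norm_dirichlet_trivial _) _.
by rewrite ler_nat ltnW// ltn_mod M_gt0.
Qed.

Lemma norm_fejer_sum1 t n : w t != 1 -> `|fejer_sum n| <= (n * M t.+1)%:R.
Proof. by move=> wt; apply: norm_psum_le => i; exact: norm_dirichlet. Qed.

(** Reduce n modulo M A.+1, then the indices of the Dirichlet kernels modulo
    M t.+1, and count terms. *)
Lemma norm_fejer_sum2 t A n : (t < A)%N -> w t != 1 -> w A != 1 ->
  `|fejer_sum n| <= (M A.+1 * M t.+1)%:R.
Proof.
move=> tA wt wA.
have mD := modulated_psum (leq0n t) modulated_wchar wt.
rewrite (modulated_norm n (modulated_psum tA mD wA)).
apply: le_trans (norm_fejer_sum1 _ wt) _.
by rewrite ler_nat leq_mul2r ltnW ?orbT// ltn_mod M_gt0.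
Qed.

Lemma norm_fejer_sum0 n : `|fejer_sum n| <= (n * n)%:R.
Proof.
apply: le_trans (ler_norm_sum _ _ _) _.
apply: (@le_trans _ _ (\sum_(i < n) n%:R)).
  apply: ler_sum => i _; apply: le_trans (norm_dirichlet_trivial _) _.
  by rewrite ler_nat ltnW.
by rewrite sumr_const card_ord natrM mulr_natl.
Qed.
End Kernel.

(** * Averages over coordinate classes of a finite quotient *)

Section FiniteModel.
Variables (R : realType) (m : nat -> nat) (L : nat).
Hypothesis m_ge2 : forall k, (2 <= m k)%N.
Local Notation M := (M_ m).

(** A finite model of the quotient of the Vilenkin group by the cylinder
    I_ L 0. *)
Definition digits := {dffun forall k : 'I_L, 'Z_(m k)}.

(** The class of x consists of the points x + j e_t + u with u vanishing in
    the first A coordinates, where e_t is the t-th unit vector; for t = A the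
    exception at t is vacuous and the class is a cylinder. *)
Definition agree (A t : nat) (x y : digits) : bool :=
  [forall k : 'I_L, ((k < A)%N && (k != t :> nat)) ==> (x k == y k)].

Lemma agreeP A t (x y : digits) :
  reflect (forall k : 'I_L, (k < A)%N -> k != t :> nat -> x k = y k)
          (agree A t x y).
Proof.
apply: (iffP forallP) => h k.
  by move=> kA kt; apply/eqP; have /implyP := h k; apply; rewrite kA.
by apply/implyP => /andP[kA kt]; apply/eqP; exact: h.
Qed.

Lemma agree_sym A t (x y : digits) : agree A t x y = agree A t y x.
Proof. by apply/agreeP/agreeP => h k kA kt; rewrite h. Qed.

Lemma card_agree A t (x : digits) : (A <= L)%N ->
  (#|[pred y | agree A t x y]| * M A = M L * (if (t < A)%N then m t else 1))%N.
Proof.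
move=> AL.
pose c k := ((k < A)%N && (k != t)).
pose F (k : 'I_L) : pred 'Z_(m k) := fun z => c k ==> (x k == z).
have -> : #|[pred y | agree A t x y]| = #|(family F : simpl_pred digits)|.
  apply: eq_card => y; apply/idP/familyP => [h k|h].
    by have /forallP/(_ k) : agree A t x y by [].
  have : agree A t x y by apply/forallP => k; exact: h k.
  by [].
rewrite card_family foldrE big_map big_enum /=.
have -> : (\prod_(k : 'I_L) #|F k| = \prod_(k < L) (if c k then 1 else m k))%N.
  apply: eq_bigr => k _; rewrite /F; case: ifP => _ /=.
    by rewrite -(card1 (x k)); apply: eq_card => z; rewrite !inE eq_sym.
  rewrite -[RHS](Zp_cast (m_ge2 k)) -[RHS]card_ord.
  by apply: eq_card => z; rewrite !inE.
have -> : (M A = \prod_(k < L) (if k < A then m k else 1))%N.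
  by rewrite /M_ (big_ord_widen L m AL) big_mkcond.
have -> : ((if t < A then m t else 1) =
           \prod_(k < L) (if (k < A) && (k == t :> nat) then m k else 1))%N.
  case: ifP => tA.
    rewrite (bigD1 (Ordinal (leq_trans tA AL)))//= tA eqxx big1 ?muln1// => k kt.
    by rewrite ifN// negb_and kt orbT.
  by rewrite big1// => k _; case: ifP => // /andP[kA /eqP kt]; rewrite kt tA in kA.
rewrite /M_ -!big_split /=; apply: eq_bigr => k _; rewrite /c.
by case: ltnP => //= _; case: eqVneq; rewrite /= ?mul1n ?muln1.
Qed.

(** Up to the bounded factor smear_mass, the conditional expectation of g at
    level A averaged over the translates of x along coordinate t.  It is the
    average against the piece of the Fejer kernel located at the scales (t, A). *)
Definition smear A t (g : digits -> R) (x : digits) : R :=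
  (M A)%:R / (M L)%:R * \sum_(y | agree A t x y) g y.

Definition determined {S : Type} N (g : digits -> S) :=
  forall x y, agree N N x y -> g x = g y.

Lemma MR_gt0 n : 0 < (M n)%:R :> R.
Proof. by rewrite ltr0n M_gt0. Qed.

Lemma smear_ge0 A t g x : (forall y, 0 <= g y) -> 0 <= smear A t g x.
Proof. by move=> g0; rewrite mulr_ge0// sumr_ge0. Qed.

Lemma le_smear A t g h x : (forall y, agree A t x y -> g y <= h y) ->
  smear A t g x <= smear A t h x.
Proof.
by move=> gh; rewrite ler_wpM2l// ler_sum.
Qed.

Lemma smearZ A t a g x : smear A t (fun y => a * g y) x = a * smear A t g x.
Proof. by rewrite /smear -mulr_sumr mulrCA. Qed.

Lemma smearD A t g h x :
  smear A t (fun y => g y + h y) x = smear A t g x + smear A t h x.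
Proof. by rewrite /smear big_split mulrDr. Qed.

Lemma smear_sum A t (I : Type) (r : seq I) (P : pred I) (g : I -> digits -> R) x :
  smear A t (fun y => \sum_(i <- r | P i) g i y) x =
  \sum_(i <- r | P i) smear A t (g i) x.
Proof. by rewrite /smear exchange_big mulr_sumr. Qed.

Definition smear_mass A t : R := (if (t < A)%N then m t else 1)%:R.

Lemma smear_cst A t x a : (A <= L)%N -> smear A t (cst a) x = smear_mass A t * a.
Proof.
move=> AL; rewrite /smear sumr_const.
have /(congr1 (fun n => n%:R : R)) := card_agree t x AL; rewrite !natrM => h.
rewrite -[a *+ _]mulr_natl mulrA; congr (_ * _).
apply: (mulfI (lt0r_neq0 (MR_gt0 L))); rewrite -h.
by field; rewrite (lt0r_neq0 (MR_gt0 L)).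
Qed.

(** As t <= A, the points of the class of x share the first t coordinates
    of x, so g is constant there. *)
Lemma smear_determined A t g x : (t <= A)%N -> (A <= L)%N -> determined t g ->
  smear A t g x = smear_mass A t * g x.
Proof.
move=> tA AL dg; rewrite -(smear_cst t x _ AL) /smear; congr (_ * _).
apply: eq_bigr => y /agreeP xy; apply: dg; apply/agreeP => k kt kt'.
by rewrite xy// (leq_trans kt).
Qed.

(** Agreement is symmetric, so every value of g is counted with the same
    multiplicity: smearing multiplies integrals by a bounded factor. *)
Lemma sum_smear A t g : (A <= L)%N ->
  \sum_x smear A t g x = smear_mass A t * \sum_x g x.
Proof.
move=> AL; rewrite -mulr_sumr (exchange_big_dep predT)//= mulr_sumr mulr_sumr.
apply: eq_bigr => y _; rewrite -(smear_cst t y _ AL) /smear; congr (_ * _).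
by apply: eq_bigl => x; rewrite agree_sym.
Qed.

(** A function of N coordinates takes each value on a whole cylinder of
    level N, which occupies a fraction M A / M N of the cylinder of level A.
    This replaces the missing convexity when p <= 1. *)
Lemma determined_le_smear N A t g x y : (A <= N)%N -> (N <= L)%N -> determined N g ->
  (forall z, 0 <= g z) -> agree A t x y ->
  (M A)%:R / (M N)%:R * g y <= smear A t g x.
Proof.
move=> AN NL dg g0 xy.
have := smear_determined y (leqnn N) NL dg.
rewrite /smear_mass ltnn mul1r => {1}<-; rewrite /smear mulrA.
have -> : (M A)%:R / (M N)%:R * ((M N)%:R / (M L)%:R) = (M A)%:R / (M L)%:R :> R.
  by field; rewrite !(lt0r_neq0 (MR_gt0 _)).
rewrite ler_wpM2l//.
rewrite (bigID (agree A t x) (fun z => agree N N y z))/=.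
rewrite [X in _ + X]big1 ?addr0 => [|z /andP[/agreeP yz /negP]]; last first.
  case; apply/agreeP => k kA kt; move/agreeP: xy => ->//.
  by apply: yz; [exact: leq_trans AN|rewrite neq_ltn (leq_trans kA AN)].
rewrite big_mkcond [leRHS]big_mkcond/=; apply: ler_sum => z _.
by case: ifPn => [/andP[_ ->]//|_]; case: ifP.
Qed.

End FiniteModel.

(** * Geometric weights and elementary power inequalities *)

Section Geometric.
Variables (R : realType) (eta : R).
Hypothesis eta01 : 0 < eta < 1.

(** Extended by 0 for k > n so that sums may range over all indices. *)
Definition geo (n k : nat) : R := if (k <= n)%N then eta ^+ (n - k) else 0.

Let eta0 : 0 <= eta. Proof. by case/andP: eta01 => /ltW. Qed.

Lemma geo_ge0 n k : 0 <= geo n k.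
Proof. by rewrite /geo; case: ifP => // _; rewrite exprn_ge0. Qed.

Lemma geo_mul n k t : (t <= k <= n)%N -> geo n t = geo n k * geo k t.
Proof.
move=> /andP[tk kn]; rewrite /geo tk kn (leq_trans tk kn) -exprD.
by congr (_ ^+ _); clear -tk kn; lia.
Qed.

Lemma sum_pow_le n : \sum_(i < n) eta ^+ i <= (1 - eta)^-1.
Proof.
case/andP: eta01 => _ e1.
rewrite -[leLHS]mulr1 -[X in _ * X](@mulfV _ (1 - eta)) ?subr_eq0 ?gt_eqF//.
rewrite mulrA ler_piMl ?invr_ge0 ?subr_ge0 ?(ltW e1)//.
have -> : (\sum_(i < n) eta ^+ i) * (1 - eta) = 1 - eta ^+ n.
  by rewrite -[RHS]opprB subrX1 -mulNr opprB mulrC.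
by rewrite gerBl exprn_ge0.
Qed.

Lemma sum_geo_r N n : \sum_(k < n) geo N k <= (1 - eta)^-1.
Proof.
apply: le_trans (sum_pow_le N.+1).
rewrite [leRHS](reindex_inj rev_ord_inj)/=.
rewrite (_ : \sum_(i < N.+1) _ = \sum_(i < N.+1) geo N i); last first.
  by apply: eq_bigr => i _; rewrite /geo -ltnS ltn_ord subSS.
have [nN|Nn] := leqP n N.+1.
  rewrite (big_ord_widen _ (geo N) nN) big_mkcond; apply: ler_sum => i _.
  by case: ifP => // _; exact: geo_ge0.
rewrite [leRHS](big_ord_widen _ (geo N) (ltnW Nn)) [leRHS]big_mkcond.
by apply: ler_sum => i _; rewrite ltnS; case: ifPn => //; rewrite /geo => /negbTE->.
Qed.

Lemma sum_geo_l k n : \sum_(N < n) geo N k <= (1 - eta)^-1.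
Proof.
apply: le_trans (sum_pow_le n).
elim: n => [|n IH]; first by rewrite !big_ord0.
have [kn|nk] := leqP k n; last first.
  rewrite big1 ?sumr_ge0// => [i _|i _]; first by rewrite exprn_ge0.
  by rewrite /geo leqNgt (leq_trans _ nk)//.
rewrite (_ : \sum_(N < n.+1) geo N k = \sum_(N < n.+1 - k) eta ^+ N).
  rewrite [leRHS](bigID (fun i : 'I_n.+1 => (i < n.+1 - k)%N))/=.
  rewrite (big_ord_widen n.+1 (fun i => eta ^+ i) (leq_subr _ _)).
  by rewrite lerDl sumr_ge0// => i _; rewrite exprn_ge0.
rewrite -(big_mkord predT (fun N => geo N k)) (big_cat_nat (n := k))//=; last by lia.
rewrite big_nat_cond big1 ?add0r => [|i /andP[/andP[_ ik] _]]; last first.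
  by rewrite /geo leqNgt ik.
rewrite -{1}[k]add0n big_addn big_mkord; apply: eq_bigr => i _.
by rewrite /geo leq_addl addnK.
Qed.

End Geometric.

Section Powers.
Variable R : realType.
Implicit Types a b h p q s U : R.

(** For p <= 1 one factor of h is linearised and the other is absorbed in
    an upper bound H of h. *)
Lemma pow_split_small h H p : 0 < p -> p <= 1 -> 0 <= h -> h <= H ->
  h <= h `^ p * H `^ (1 - p).
Proof.
move=> p0 p1 h0 hH; have [->|hn0] := eqVneq h 0.
  by rewrite mulr_ge0// powR_ge0.
have hp : 0 < h by rewrite lt0r hn0.
apply: (@le_trans _ _ (h `^ p * h `^ (1 - p))).
  by rewrite -powRD ?hn0 ?implybT// addrC subrK powRr1.
by rewrite ler_wpM2l ?powR_ge0// ge0_ler_powR// ?nnegrE ?subr_ge0// (le_trans h0).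
Qed.

(** A linear substitute for Jensen's inequality: with s the size that is to
    be proved, values of h below s are harmless and larger ones are dominated
    by a multiple of their p-th power. *)
Lemma pow_split_large h s p : 1 <= p -> 0 <= h -> 0 < s ->
  h <= s + s `^ (1 - p) * h `^ p.
Proof.
move=> p1 h0 s0; have [hs|sh] := leP h s.
  by rewrite (le_trans hs)// lerDl mulr_ge0 ?powR_ge0.
have hp : 0 < h by exact: lt_trans sh.
rewrite (@le_trans _ _ (s `^ (1 - p) * h `^ p))// ?lerDr ?(ltW s0)//.
apply: (@le_trans _ _ (h `^ (1 - p) * h `^ p)).
  by rewrite -powRD ?(gt_eqF hp) ?implybT// subrK powRr1.
rewrite ler_wpM2r ?powR_ge0//.
have e x : 0 < x -> x `^ (1 - p) = (x `^ (p - 1))^-1.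
  by move=> x0; rewrite -powRN opprB.
rewrite !e// lef_pV2 ?posrE ?powR_gt0//.
by rewrite ge0_ler_powR// ?nnegrE ?subr_ge0// ltW.
Qed.
End Powers.

(** * The p-th power of the sum over scales *)

Section PowerMean.
Variables (R : realType) (m : nat -> nat) (B : nat).
Hypothesis m_ge2 : forall k, (2 <= m k)%N.
Hypothesis m_leB : forall k, (m k <= B)%N.
Local Notation M := (M_ m).
Local Notation MR n := ((M n)%:R : R).

Lemma B_ge1 : 1 <= B%:R :> R.
Proof. by rewrite ler1n; have := m_ge2 0; have := m_leB 0; lia. Qed.

Lemma smear_mass_le A t : smear_mass R m A t <= B%:R.
Proof.
rewrite /smear_mass ler_nat; case: ifP => // _.
by have := m_ge2 0; have := m_leB 0; lia.
Qed.

Lemma smear_mass_ge0 A t : 0 <= smear_mass R m A t.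
Proof. by []. Qed.

Let M0 n : 0 < MR n. Proof. exact: MR_gt0. Qed.

Lemma M_ratio_le t A : (t <= A)%N -> MR t / MR A <= 2^-1 ^+ (A - t).
Proof.
move=> /subnKC <-; elim: (A - t)%N => [|d IH].
  by rewrite addn0 subnn expr0 divff// lt0r_neq0.
rewrite addnS subSn ?leq_addr// exprSr M_S natrM invfM mulrA.
rewrite ler_pM ?invr_ge0// lef_pV2 ?posrE ?ltr0n ?ler_nat//.
by have := m_ge2 (t + d); lia.
Qed.

Lemma half_powR_lt1 (e : R) : 0 < e -> 0 < 2^-1 `^ e < 1.
Proof.
move=> e0; rewrite powR_gt0 ?invr_gt0//=.
rewrite [ltRHS](_ : 1 = 1 `^ e); last by rewrite powR1.
by apply: gt0_ltr_powR => //; rewrite ?nnegrE; lra.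
Qed.

(** Since every m k is at least 2, ratios of the block lengths decay
    geometrically. *)
Lemma M_ratio_powR_le (e s : R) t A : 0 < e -> e <= s -> (t <= A)%N ->
  (MR t / MR A) `^ s <= geo (2^-1 `^ e) A t.
Proof.
move=> e0 es tA; rewrite /geo tA.
have r0 : 0 < MR t / MR A by rewrite divr_gt0.
have r1 : MR t / MR A <= 1.
  by rewrite ler_pdivrMr// mul1r ler_nat M_le.
apply: (@le_trans _ _ ((MR t / MR A) `^ e)).
  by apply: ger_powR => //; rewrite r0.
rewrite -powR_mulrn ?powR_ge0// -powRrM [e * _]mulrC powRrM powR_mulrn ?invr_ge0//.
by rewrite ge0_ler_powR ?nnegrE ?(ltW e0) ?(ltW r0) ?exprn_ge0 ?invr_ge0// M_ratio_le.
Qed.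

Variable L : nat.
Local Notation index := ('I_L.+1 * 'I_L.+1)%type.
Local Notation T := (digits m L).
Implicit Types (h g : T -> R) (x : T).

(** The bound that the kernel estimate gives for the Fejer means of index
    comparable with M N. *)
Definition scale_sum N h x : R :=
  \sum_(i : index | (i.2 <= i.1 <= N)%N)
    MR i.2 / MR N * smear i.1 i.2 h x.

(** What remains of scale_sum after taking p-th powers: only the geometric
    decay of the weights away from scale N is kept, one factor for the sum over
    A and one for the sum over t. *)
Definition geo_sum (eta : R) N g x : R :=
  \sum_(i : index | (i.2 <= i.1)%N)
    geo eta N i.1 * geo eta N i.2 * smear i.1 i.2 g x.

Lemma geo_sumE eta N g x : geo_sum eta N g x =
  \sum_(i : index | (i.2 <= i.1 <= N)%N)
    geo eta N i.1 * geo eta N i.2 * smear i.1 i.2 g x.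
Proof.
rewrite /geo_sum big_mkcond [RHS]big_mkcond; apply: eq_bigr => i _.
case: leqP => //= _; case: leqP => // Ni.
by rewrite /geo leqNgt Ni/= !mul0r.
Qed.

Lemma scale_sum_ge0 N h x : (forall y, 0 <= h y) -> 0 <= scale_sum N h x.
Proof.
move=> h0; apply: sumr_ge0 => i _; by rewrite mulr_ge0 ?divr_ge0 ?smear_ge0.
Qed.

Lemma geo_sum_ge0 eta N g x : 0 < eta < 1 -> (forall y, 0 <= g y) ->
  0 <= geo_sum eta N g x.
Proof.
move=> e g0; apply: sumr_ge0 => i _.
by apply: mulr_ge0; [rewrite mulr_ge0 ?geo_ge0|exact: smear_ge0].
Qed.

(** The weight is (M t / M A) ^ p * (M A / M N) ^ (2 p - 1); it decays in
    N - A exactly because p > 1/2. *)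
Lemma weight_bound_small p A t N : 2^-1 < p -> p <= 1 -> (t <= A <= N)%N ->
  (MR t / MR N) `^ p * (MR A / MR N) `^ (p - 1) <=
  geo (2^-1 `^ (p - 2^-1)) N A * geo (2^-1 `^ (p - 2^-1)) N t.
Proof.
move=> p12 p1 /andP[tA AN]; set e := p - 2^-1.
have e0 : 0 < e by rewrite subr_gt0.
have e2 : e + e = p + (p - 1) by rewrite /e; lra.
have q0 n k : 0 < MR n / MR k by rewrite divr_gt0.
have -> : MR t / MR N = MR t / MR A * (MR A / MR N).
  by field; rewrite !lt0r_neq0.
rewrite powRM ?(ltW (q0 _ _))// -mulrA -powRD ?(gt_eqF (q0 _ _)) ?implybT//.
rewrite -e2 powRD ?(gt_eqF (q0 _ _)) ?implybT//.
rewrite (@geo_mul _ _ N A t) ?tA// [leLHS]mulrC -mulrA.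
have g n k := geo_ge0 (half_powR_lt1 e0) n k.
have h n k : (k <= n)%N -> (MR k / MR n) `^ e <= geo (2^-1 `^ e) n k.
  by move=> kn; exact: M_ratio_powR_le.
rewrite ler_pM ?powR_ge0 ?mulr_ge0 ?powR_ge0 ?h//.
rewrite ler_pM ?powR_ge0 ?h//.
by apply: M_ratio_powR_le => //; rewrite /e; lra.
Qed.

(** Call U the sum with the weights w of weight_bound_small.  Each term of U
    is at most U, and by determined_le_smear it controls the values of h on the
    class involved; inserting this bound into h = h ^ p * h ^ (1 - p) gives
    scale_sum <= U ^ (1 / p). *)
Lemma scale_sum_pow_small p N h x : 2^-1 < p -> p <= 1 -> (N <= L)%N ->
  (forall y, 0 <= h y) -> determined N h ->
  (scale_sum N h x) `^ p <= geo_sum (2^-1 `^ (p - 2^-1)) N (fun y => h y `^ p) x.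
Proof.
move=> p12 p1 NL h0 hd; have p0 : 0 < p by apply: lt_trans p12; rewrite invr_gt0.
pose w A t := (MR t / MR N) `^ p * (MR A / MR N) `^ (p - 1).
pose u A t := smear A t (fun y : T => h y `^ p) x.
have u0 A t : 0 <= u A t by apply: smear_ge0 => y; exact: powR_ge0.
have w0 A t : 0 < w A t by rewrite mulr_gt0// powR_gt0// divr_gt0.
pose U := \sum_(i : index | (i.2 <= i.1 <= N)%N) w i.1 i.2 * u i.1 i.2.
have U0 : 0 <= U by apply: sumr_ge0 => i _; rewrite mulr_ge0// ltW.
suff VU : (scale_sum N h x) `^ p <= U.
  apply: le_trans VU _; rewrite geo_sumE; apply: ler_sum => i iN.
  by rewrite ler_wpM2r// weight_bound_small.
(* The bound on h that the single term of index (A, t) of U provides. *)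
pose H A t := U `^ p^-1 / (MR t / MR N * (MR A / MR N)).
have r0 n k : 0 < MR n / MR k by rewrite divr_gt0.
have hH (i : index) y : (i.2 <= i.1 <= N)%N -> agree i.1 i.2 x y -> h y <= H i.1 i.2.
  move=> /andP[tA AN] xy.
  rewrite ler_pdivlMr ?(mulr_gt0 (r0 _ _) (r0 _ _))//.
  rewrite -[leLHS]powRr1 ?mulr_ge0 ?h0 ?(ltW (r0 _ _))//.
  rewrite -[X in _ `^ X <= _](@mulfV _ p) ?gt_eqF//.
  rewrite powRrM ge0_ler_powR ?nnegrE ?powR_ge0 ?invr_ge0 ?(ltW p0)//.
  have : w i.1 i.2 * u i.1 i.2 <= U.
    rewrite /U (bigD1 i) ?tA//= lerDl sumr_ge0// => j _.
    by rewrite mulr_ge0// ltW.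
  apply: le_trans.
  have dp : determined N (fun y : T => h y `^ p).
    by move=> a b ab; rewrite (hd a b ab).
  have := determined_le_smear m_ge2 AN NL dp (fun z => powR_ge0 _ _) xy.
  move/(ler_wpM2l (ltW (w0 i.1 i.2))); apply: le_trans.
  rewrite /w; move: (r0 i.2 N) (r0 i.1 N).
  set a := _ / MR N; set b := _ / MR N; clearbody a b => a0 b0.
  rewrite !powRM ?mulr_ge0 ?h0 ?(ltW a0) ?(ltW b0)//.
  rewrite mulrC -!mulrA ler_wpM2l ?powR_ge0//.
  rewrite mulrA ler_wpM2r ?powR_ge0//.
  rewrite -[X in _ <= _ * X](@powRr1 _ b) ?(ltW b0)//.
  by rewrite -powRD ?(gt_eqF b0) ?implybT// subrK.
have VU : scale_sum N h x <= U `^ ((1 - p) / p) * U.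
  apply: (@le_trans _ _ (\sum_(i : index | (i.2 <= i.1 <= N)%N)
    U `^ ((1 - p) / p) * (w i.1 i.2 * u i.1 i.2))); last by rewrite -mulr_sumr.
  rewrite /scale_sum; apply: ler_sum => j jN.
  have : smear j.1 j.2 h x <= H j.1 j.2 `^ (1 - p) * u j.1 j.2.
    rewrite /u -smearZ; apply: le_smear => y xy.
    by rewrite mulrC; apply: pow_split_small => //; exact: hH.
  move/(ler_wpM2l (ltW (r0 j.2 N))) => /le_trans; apply.
  rewrite [leLHS]mulrA [leRHS]mulrA; apply: ler_wpM2r; first exact: u0.
  rewrite /H /w; move: (r0 j.2 N) (r0 j.1 N).
  set a := _ / MR N; set b := _ / MR N; clearbody a b => a0 b0.
    rewrite powRM ?powR_ge0 ?invr_ge0 ?mulr_ge0 ?(ltW a0) ?(ltW b0)//.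
  rewrite -powRrM [p^-1 * _]mulrC mulrCA ler_wpM2l ?powR_ge0//.
  rewrite -powR_inv1 ?mulr_ge0 ?(ltW a0) ?(ltW b0)// -powRrM mulN1r opprB.
  rewrite powRM ?(ltW a0) ?(ltW b0)// mulrA ler_wpM2r ?powR_ge0//.
  rewrite -[X in X * _](@powRr1 _ a) ?(ltW a0)//.
  by rewrite -powRD ?(gt_eqF a0) ?implybT// addrC subrK.
have pV : p^-1 = (1 - p) / p + 1 by field; rewrite gt_eqF.
have -> : U = (U `^ p^-1) `^ p by rewrite -powRrM mulVf ?gt_eqF// powRr1.
rewrite ge0_ler_powR ?nnegrE ?powR_ge0 ?(ltW p0) ?scale_sum_ge0//.
apply: le_trans VU _.
rewrite [in leRHS]pV powRD ?powRr1//.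
by rewrite -pV gt_eqF ?invr_gt0.
Qed.

(** Apply pow_split_large with s ^ p just above U = geo_sum.  The weights
    M t / M N have bounded sum over the scales, so scale_sum is at most a constant times s.
    The perturbation by eps keeps s positive when U = 0. *)
Lemma scale_sum_pow_large p N h x : 1 <= p -> (N <= L)%N ->
  (forall y, 0 <= h y) ->
  (scale_sum N h x) `^ p <=
  (B%:R / (1 - 2^-1 `^ 2^-1) ^+ 2 + 1) `^ p *
    geo_sum (2^-1 `^ 2^-1) N (fun y => h y `^ p) x.
Proof.
move=> p1 NL h0; have p0 : 0 < p by apply: lt_le_trans p1.
set d : R := 2^-1 `^ 2^-1.
have d01 : 0 < d < 1 by apply: half_powR_lt1; rewrite invr_gt0.
set K := B%:R / (1 - d) ^+ 2 + 1.
have K0 : 0 < K by rewrite ltr_wpDl// divr_ge0// exprn_ge0// subr_ge0 ltW//; case/andP: d01.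
have w_le (i : index) : (i.2 <= i.1 <= N)%N ->
    MR i.2 / MR N <= geo d N i.1 * geo d N i.2.
  move=> /andP[tA AN]; have tN := leq_trans tA AN.
  have r0 n k : 0 < MR n / MR k by rewrite divr_gt0.
  have e0 : 0 < 2^-1 :> R by rewrite invr_gt0.
  rewrite -[leLHS]powRr1 ?(ltW (r0 _ _))// [X in _ `^ X <= _](_ : 1 = 2^-1 + 2^-1);
    last by lra.
  rewrite powRD ?(gt_eqF (r0 _ _)) ?implybT//.
  rewrite ler_pM ?powR_ge0//; last exact: M_ratio_powR_le e0 (lexx _) tN.
  apply: le_trans (M_ratio_powR_le e0 (lexx _) tN) _.
  rewrite (@geo_mul _ _ N i.1 i.2) ?tA// ler_piMr ?geo_ge0//.
  rewrite /geo tA exprn_ile1//; by case/andP: d01 => /ltW ? /ltW.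
set U := geo_sum _ _ _ _.
have U0 : 0 <= U by apply: geo_sum_ge0 => // y; exact: powR_ge0.
have VK s : 0 < s -> U <= s `^ p -> scale_sum N h x <= K * s.
  move=> s0 Us.
  apply: (@le_trans _ _ (\sum_(i : index | (i.2 <= i.1 <= N)%N)
     (geo d N i.1 * geo d N i.2 * (B%:R * s) +
      s `^ (1 - p) * (geo d N i.1 * geo d N i.2 *
        smear i.1 i.2 (fun y => h y `^ p) x)))).
    apply: ler_sum => i iN; rewrite [s `^ _ * _]mulrCA -mulrDr.
    have iL : (i.1 <= L)%N by rewrite -ltnS ltn_ord.
    rewrite ler_pM ?divr_ge0 ?smear_ge0 ?w_le//.
    apply: (@le_trans _ _ (smear_mass R m i.1 i.2 * s +
        s `^ (1 - p) * smear i.1 i.2 (fun y => h y `^ p) x)).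
      rewrite -(smear_cst m_ge2 i.2 x _ iL) -smearZ -smearD.
      by apply: le_smear => y _; exact: pow_split_large.
    by rewrite lerD2r ler_wpM2r ?smear_mass_le// ltW.
  rewrite big_split/= -mulr_sumr -geo_sumE -/U -mulr_suml mulrDl mul1r lerD//.
    rewrite [leRHS](_ : _ = ((1 - d) ^+ 2)^-1 * (B%:R * s)); last by rewrite mulrCA mulrA.
    apply: ler_wpM2r; first by rewrite mulr_ge0 ?(ltW s0).
    apply: (@le_trans _ _ (\sum_(i : index) geo d N i.1 * geo d N i.2)).
      rewrite big_mkcond; apply: ler_sum => i _; case: ifP => // _.
      by rewrite mulr_ge0 ?geo_ge0.
    rewrite -(pair_bigA _ (fun a b : 'I_L.+1 => geo d N a * geo d N b))/=.
    under eq_bigr do rewrite -mulr_sumr.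
    rewrite -mulr_suml -exprVn expr2 ler_pM ?sum_geo_r ?sumr_ge0// => i _; exact: geo_ge0.
  apply: (@le_trans _ _ (s `^ (1 - p) * s `^ p)).
    by rewrite ler_wpM2l ?powR_ge0.
  by rewrite -powRD ?(gt_eqF s0) ?implybT// subrK powRr1// ltW.
apply/ler_addgt0Pr => eps eps0.
(* With this s, K ^ p * s ^ p is K ^ p * U + eps. *)
pose s := (U + eps / K `^ p) `^ p^-1.
have Ue : 0 < U + eps / K `^ p by rewrite ltr_wpDl// divr_gt0// powR_gt0.
have sp : s `^ p = U + eps / K `^ p by rewrite -powRrM mulVf ?gt_eqF// powRr1// ltW.
have s0 : 0 < s by rewrite powR_gt0.
have := VK s s0; rewrite sp lerDl divr_ge0 ?powR_ge0 ?(ltW eps0)// => /(_ isT) V.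
apply: (@le_trans _ _ ((K * s) `^ p)).
  by rewrite ge0_ler_powR ?nnegrE ?(ltW p0) ?scale_sum_ge0 ?mulr_ge0 ?(ltW K0) ?(ltW s0).
rewrite powRM ?(ltW K0) ?(ltW s0)// sp mulrDr lerD2l mulrC divfK ?gt_eqF ?powR_gt0//.
Qed.

End PowerMean.

(** * The maximal inequality on a finite quotient *)

Section FiniteMaximal.
Variables (R : realType) (m : nat -> nat) (B : nat).
Hypothesis m_ge2 : forall k, (2 <= m k)%N.
Hypothesis m_leB : forall k, (m k <= B)%N.
Local Notation M := (M_ m).

Lemma scale_sum_pow (p : R) : 2^-1 < p -> exists eta K : R,
  [/\ 0 < eta < 1, 0 < K & forall L N (h : digits m L -> R) x,
    (N <= L)%N -> (forall y, 0 <= h y) -> determined N h ->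
    (scale_sum N h x) `^ p <= K * geo_sum eta N (fun y => h y `^ p) x].
Proof.
move=> p12; have [p1|/ltW p1] := leP p 1.
  exists (2^-1 `^ (p - 2^-1)), 1; split=> //.
    by rewrite half_powR_lt1 ?subr_gt0.
  by move=> L N h x NL h0 hd; rewrite mul1r scale_sum_pow_small.
have d01 : 0 < (2^-1 : R) `^ 2^-1 < 1 by apply: half_powR_lt1; rewrite invr_gt0.
exists (2^-1 `^ 2^-1), ((B%:R / (1 - 2^-1 `^ 2^-1) ^+ 2 + 1) `^ p); split=> //.
  rewrite powR_gt0// ltr_wpDl// divr_ge0// exprn_ge0// subr_ge0 ltW//.
  by case/andP: d01.
by move=> L N h x NL h0 _; exact: scale_sum_pow_large.
Qed.

Variables (eta : R) (L : nat).
Hypothesis eta01 : 0 < eta < 1.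
Local Notation T := (digits m L).
Local Notation index := ('I_L.+1 * 'I_L.+1)%type.
Local Notation gam := ((1 - eta)^-1).

Let geo0 n k : 0 <= geo eta n k. Proof. exact: geo_ge0. Qed.
Let gam0 : 0 <= gam.
Proof. by rewrite invr_ge0 subr_ge0 ltW//; case/andP: eta01. Qed.

Variable F : nat -> T -> R.
Hypothesis F_ge0 : forall n x, 0 <= F n x.
Hypothesis F_nondecr : forall n x, F n x <= F n.+1 x.
Hypothesis F_det : forall n, determined n (F n).

Definition increment n x := F n x - (if n is k.+1 then F k x else 0).

Lemma increment_ge0 n x : 0 <= increment n x.
Proof. by rewrite /increment subr_ge0; case: n => [|n]. Qed.

Lemma sum_increment n x : \sum_(k < n.+1) increment k x = F n x.
Proof.
elim: n => [|n IH]; first by rewrite big_ord1 /increment subr0.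
by rewrite big_ord_recr /= IH /increment addrC subrK.
Qed.

Lemma F_le i j x : (i <= j)%N -> F i x <= F j x.
Proof.
move=> /subnKC <-; elim: (j - i)%N => [|d IH]; first by rewrite addn0.
by rewrite addnS (le_trans IH).
Qed.

(** F N is F t plus the increments of index in (t, N], and the weight of such
    an increment factors at its own index K. *)
Lemma geo_telescope N t x : (t <= N)%N -> (N <= L)%N ->
  geo eta N t * F N x <= geo eta N t * F t x +
    \sum_(K < L.+1) geo eta N K * geo eta K t * increment K x.
Proof.
move=> tN NL; rewrite -lerBlDl -mulrBr.
have -> : F N x - F t x = \sum_(K < L.+1 | (t < K <= N)%N) increment K x.
  rewrite -(sum_increment N) -(sum_increment t).
  rewrite (big_ord_widen L.+1 (increment^~ x)) ?ltnS//.
  rewrite (big_ord_widen L.+1 (increment^~ x)) ?ltnS ?(leq_trans tN)//.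
  rewrite (bigID (fun k : 'I_L.+1 => (k <= t)%N))/= addrC.
  rewrite [X in _ + X - _](eq_bigl (fun k : 'I_L.+1 => (k < t.+1)%N)) ?addrK.
    by apply: eq_bigl => k; rewrite ltnS -ltnNge andbC.
  by move=> k; rewrite !ltnS andbC andb_idr// => /leq_trans; apply.
rewrite mulr_sumr big_mkcond; apply: ler_sum => K _; case: ifP => [/andP[tK KN]|_].
  by rewrite (@geo_mul _ _ N K t) ?KN ?(ltnW tK).
by rewrite !mulr_ge0// increment_ge0.
Qed.

(** The supremum over N is replaced by the sum over N, but only for the
    increments of F: their integrals telescope, whereas nothing controls the
    sum over N of the F N themselves. *)
Definition majorant x :=
  B%:R * gam ^+ 2 * F L x +
  \sum_(N < L.+1) \sum_(i : index | (i.2 <= i.1)%N) \sum_(K < L.+1)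
    geo eta N i.1 * (geo eta N K * geo eta K i.2) *
      smear i.1 i.2 (increment K) x.

(** After geo_telescope, smearing leaves F t unchanged up to a bounded
    factor and F t <= F L; the increments are the single term of index N in the
    majorant. *)
Lemma geo_sum_le_majorant N x : (N <= L)%N -> geo_sum eta N (F N) x <= majorant x.
Proof.
move=> NL; rewrite geo_sumE.
apply: (@le_trans _ _ (\sum_(i : index | (i.2 <= i.1 <= N)%N)
  (geo eta N i.1 * geo eta N i.2 * (B%:R * F L x) + \sum_(K < L.+1)
    geo eta N i.1 * (geo eta N K * geo eta K i.2) *
      smear i.1 i.2 (increment K) x))).
  apply: ler_sum => i /andP[tA AN]; have tN := leq_trans tA AN.
  have AL : (i.1 <= L)%N by rewrite -ltnS ltn_ord.
  rewrite -mulrA -smearZ -mulrA.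
  under [X in _ + X]eq_bigr do rewrite -mulrA.
  rewrite -mulr_sumr -mulrDr ler_wpM2l//.
  apply: le_trans (_ : smear i.1 i.2 (fun y => geo eta N i.2 * F i.2 y +
      \sum_(K < L.+1) geo eta N K * geo eta K i.2 * increment K y) x <= _).
    by apply: le_smear => y _; exact: geo_telescope.
  rewrite smearD smear_sum; apply: lerD.
    rewrite smearZ smear_determined// ler_wpM2l// ler_pM ?smear_mass_ge0 ?smear_mass_le//.
    exact: F_le (leq_trans tN NL).
  by apply: ler_sum => K _; rewrite smearZ.
rewrite big_split/= /majorant lerD//.
  rewrite -mulr_suml [leRHS]mulrAC [leRHS]mulrC.
  apply: ler_wpM2r; first by rewrite mulr_ge0.
  apply: (@le_trans _ _ (\sum_(i : index) geo eta N i.1 * geo eta N i.2)).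
    by rewrite big_mkcond; apply: ler_sum => i _; case: ifP => // _; rewrite mulr_ge0.
  rewrite -(pair_bigA _ (fun a b : 'I_L.+1 => geo eta N a * geo eta N b))/=.
  under eq_bigr do rewrite -mulr_sumr.
  by rewrite -mulr_suml expr2 ler_pM ?sum_geo_r ?sumr_ge0.
have t0 (n : 'I_L.+1) (i : index) : 0 <= \sum_(K < L.+1)
    geo eta n i.1 * (geo eta n K * geo eta K i.2) * smear i.1 i.2 (increment K) x.
  apply: sumr_ge0 => K _; apply: mulr_ge0; first by rewrite !mulr_ge0.
  by apply: smear_ge0 => // y; exact: increment_ge0.
have NL' : (N < L.+1)%N by [].
rewrite (bigD1 (Ordinal NL'))//= ler_wpDr//.
  by apply: sumr_ge0 => n _; apply: sumr_ge0.
rewrite big_mkcond [leRHS]big_mkcond; apply: ler_sum => i _.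
case: leqP => //= _; case: ifP => // _; exact: (t0 (Ordinal NL')).
Qed.

(** Smearing at most multiplies the integral of an increment by B.  For fixed
    K the weights are summable over N, A and t, and the integrals of the
    increments telescope to that of F L. *)
Lemma sum_majorant : \sum_x majorant x <=
  (B%:R * gam ^+ 2 + B%:R * gam ^+ 3) * \sum_x F L x.
Proof.
rewrite /majorant big_split/= -mulr_sumr mulrDl lerD2l.
have D0 K : 0 <= \sum_x increment K x by apply: sumr_ge0 => x _; exact: increment_ge0.
have SD : \sum_(K < L.+1) \sum_x increment K x = \sum_x F L x.
  by rewrite exchange_big; apply: eq_bigr => x _; exact: sum_increment.
rewrite -SD exchange_big/=.
apply: (@le_trans _ _ (\sum_(N < L.+1) \sum_(i : index) \sum_(K < L.+1)
   geo eta N i.1 * (geo eta N K * geo eta K i.2) * (B%:R * \sum_x increment K x))).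
  apply: ler_sum => N _; rewrite exchange_big/= big_mkcond; apply: ler_sum => i _.
  case: ifP => _; last by apply: sumr_ge0 => K _; rewrite !mulr_ge0.
  rewrite exchange_big/=; apply: ler_sum => K _.
  rewrite -mulr_sumr ler_wpM2l ?mulr_ge0//.
  rewrite sum_smear// ?ler_wpM2r ?smear_mass_le//.
  by rewrite -ltnS ltn_ord.
apply: (@le_trans _ _ (\sum_(N < L.+1) \sum_(t < L.+1) \sum_(K < L.+1)
   gam * (geo eta N K * geo eta K t) * (B%:R * \sum_x increment K x))).
  apply: ler_sum => N _.
  rewrite -(pair_bigA _ (fun a b : 'I_L.+1 => \sum_(K < L.+1)
    geo eta N a * (geo eta N K * geo eta K b) * (B%:R * \sum_x increment K x)))/=.
  rewrite exchange_big/=; apply: ler_sum => t _.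
  rewrite exchange_big/=; apply: ler_sum => K _.
  rewrite -!mulr_suml ler_wpM2r ?mulr_ge0// ler_wpM2r ?mulr_ge0//.
  exact: sum_geo_r.
under [leLHS]eq_bigr => N _ do rewrite exchange_big/=.
rewrite exchange_big/= mulr_sumr; apply: ler_sum => K _.
under [leLHS]eq_bigr => N _ do rewrite -mulr_suml -mulr_sumr -mulr_sumr.
rewrite -mulr_suml -mulr_sumr -mulr_suml mulrA [B%:R * gam ^+ 3]mulrC.
rewrite ler_wpM2r// ler_wpM2r// exprS ler_wpM2l// expr2.
by rewrite ler_pM ?sumr_ge0 ?sum_geo_r ?sum_geo_l.
Qed.

End FiniteMaximal.

(** * Functions of finitely many coordinates and their integrals *)

Section Cylindrical.
Variables (R : realType) (m : nat -> nat).
Hypothesis m_ge2 : forall k, (2 <= m k)%N.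
Local Notation G := (vilenkin m).
Local Notation M := (M_ m).

Definition cylindrical {S : Type} N (g : G -> S) :=
  forall x y : G, (forall k, (k < N)%N -> x k = y k) -> g x = g y.

(** A section of trunc: coordinates from L on are set to 0. *)
Definition extend L (y : digits m L) : G := fun k =>
  match boolP (k < L)%N with
  | AltTrue h => y (Ordinal h)
  | AltFalse _ => 0
  end.

Definition trunc L (x : G) : digits m L := finfun (fun k : 'I_L => x k).

Lemma extendE L (y : digits m L) (k : 'I_L) : extend y k = y k.
Proof.
case: k => k kL; rewrite /extend; case: {-}_ / boolP => [h|]; last by rewrite kL.
by rewrite /= (bool_irrelevance h kL).
Qed.

Lemma extend_trunc L (x : G) k : (k < L)%N -> extend (trunc L x) k = x k.
Proof. by move=> kL; rewrite (extendE _ (Ordinal kL)) ffunE. Qed.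

Lemma cylindrical_trunc (S : Type) N L (g : G -> S) x : (N <= L)%N ->
  cylindrical N g -> g (extend (trunc L x)) = g x.
Proof. by move=> NL; apply => k kN; rewrite extend_trunc// (leq_trans kN). Qed.

Lemma determined_extend (S : Type) N L (g : G -> S) :
  cylindrical N g -> determined N (fun y : digits m L => g (extend y)).
Proof.
move=> gN x y /agreeP xy; apply: gN => k kN; have [kL|Lk] := boolP (k < L)%N.
  by rewrite !(extendE _ (Ordinal kL)) xy//= neq_ltn kN.
by rewrite /extend; case: {-}_ / boolP => // kL; rewrite kL in Lk.
Qed.

Lemma cylindrical_widen (S : Type) N L (g : G -> S) : (N <= L)%N ->
  cylindrical N g -> cylindrical L g.
Proof. by move=> NL gN x y xy; apply: gN => k kN; apply: xy; apply: leq_trans NL. Qed.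

Lemma mem_I_extend L (x : G) (y : digits m L) :
  I_ L (extend y) x <-> y = trunc L x.
Proof.
split=> [xy|-> k kL]; last by rewrite extend_trunc.
by apply/ffunP => k; rewrite ffunE xy// extendE.
Qed.

Lemma cylindrical_indicE L (g : G -> R) : cylindrical L g ->
  g = fun x => \sum_(y : digits m L) g (extend y) * \1_(I_ L (extend y)) x.
Proof.
move=> gL; apply/funext => x; rewrite (bigD1 (trunc L x))//= big1 ?addr0.
  rewrite indicE mem_set ?mulr1; last exact/mem_I_extend.
  by rewrite (cylindrical_trunc x (leqnn L) gL).
move=> y yx; rewrite indicE memNset ?mulr0// => /mem_I_extend yE.
by rewrite yE eqxx in yx.
Qed.

Lemma measurable_cylindrical L (g : G -> R) :
  cylindrical L g -> measurable_fun setT g.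
Proof.
move=> /cylindrical_indicE ->; apply: measurable_sum => y.
apply: measurable_funM; first exact: measurable_cst.
by apply: measurable_indic; exact: ProductMeasure.measurable_I.
Qed.

Variables (mu : probability G R) (mu_product : is_product_measure mu).

Lemma mu_I L (x : G) : mu (I_ L x) = ((M L)%:R^-1)%:E.
Proof.
have := mu_product L (fun k => [set x k]%SET).
have -> : [set y : G | forall k, (k < L)%N -> y k \in [set x k]%SET] = I_ L x.
  by apply/seteqP; split => y /= h k /h; rewrite inE => /eqP.
move=> ->; congr EFin.
rewrite (eq_bigr (fun k : 'I_L => (m k)%:R^-1)) => [|k _].
  by rewrite prodfV /M_ natr_prod.
by rewrite /coord_measure big_set1.
Qed.

(** Cylinders of level L all have measure 1 / M L, so integrating a function
    of L coordinates is averaging it over the finite model. *)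
Lemma cylindrical_integral L (g : G -> R) : cylindrical L g ->
  (\int[mu]_x (g x)%:E =
     ((M L)%:R^-1 * \sum_(y : digits m L) g (extend y))%:E)%E.
Proof.
move=> gL.
have mI (y : digits m L) : measurable (I_ L (extend y) : set G).
  exact: ProductMeasure.measurable_I.
transitivity (\int[mu]_x \sum_(y : digits m L)
    (g (extend y))%:E * (\1_(I_ L (extend y)) x)%:E)%E.
  apply: eq_integral => x _; rewrite [in LHS](cylindrical_indicE gL) -sumEFin.
  by apply: eq_bigr => y _; rewrite EFinM.
rewrite integral_sum//; last first.
  by move=> y; apply: integrableZl => //; exact: integrable_indic.
rewrite mulr_sumr -sumEFin; apply: eq_bigr => y _.
rewrite integralZl//; last exact: integrable_indic.
rewrite integral_indic// setIT mulrC EFinM; congr (_ * _)%E; exact: mu_I.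
Qed.

Lemma cylindrical_Rintegral L (g : G -> R) : cylindrical L g ->
  Rintegral mu setT g = (M L)%:R^-1 * \sum_(y : digits m L) g (extend y).
Proof. by move=> gL; rewrite /Rintegral (cylindrical_integral gL). Qed.

End Cylindrical.

(** * Complex numbers, roots of unity and the Vilenkin characters *)

Section Complex.
Variable R : realType.
Implicit Types z : R[i].
Local Open Scope complex_scope.

Lemma Re_sum (I : Type) (r : seq I) (P : pred I) (z : I -> R[i]) :
  complex.Re (\sum_(i <- r | P i) z i) = \sum_(i <- r | P i) complex.Re (z i).
Proof. by apply: (big_morph (fun z : R[i] => complex.Re z)) => // -[a b] [c d]. Qed.

Lemma Im_sum (I : Type) (r : seq I) (P : pred I) (z : I -> R[i]) :
  complex.Im (\sum_(i <- r | P i) z i) = \sum_(i <- r | P i) complex.Im (z i).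
Proof. by apply: (big_morph (fun z : R[i] => complex.Im z)) => // -[a b] [c d]. Qed.

Lemma Re_scale (a : R) z : complex.Re (a%:C * z) = a * complex.Re z.
Proof. by case: z => b c; rewrite /= mul0r subr0. Qed.

Lemma Im_scale (a : R) z : complex.Im (a%:C * z) = a * complex.Im z.
Proof. by case: z => b c; rewrite /= mul0r addr0. Qed.

Lemma normc_ge0 z : 0 <= Normc.normc z.
Proof. by case: z => a b; rewrite /= sqrtr_ge0. Qed.

Lemma normc_le z (a : R) : (Normc.normc z <= a) = (`|z| <= a%:C).
Proof. by rewrite -lecR. Qed.

Lemma normc_sum (I : Type) (r : seq I) (P : pred I) (z : I -> R[i]) :
  Normc.normc (\sum_(i <- r | P i) z i) <= \sum_(i <- r | P i) Normc.normc (z i).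
Proof.
rewrite normc_le rmorph_sum /=; apply: le_trans (ler_norm_sum _ _ _) _.
by [].
Qed.

Lemma normc_real (a : R) : 0 <= a -> Normc.normc a%:C = a.
Proof. by move=> a0; rewrite /= expr0n addr0 sqrtr_sqr ger0_norm. Qed.

Lemma cos_sin_exp (t : R) n :
  (cos t +i* sin t) ^+ n = cos (t *+ n) +i* sin (t *+ n).
Proof.
elim: n => [|n IH]; first by rewrite expr0 mulr0n cos0 sin0.
rewrite exprSr IH mulrSr cosD sinD; apply/eqP.
by rewrite eq_complex /= eqxx [X in _ == X]addrC eqxx.
Qed.

Lemma cos_sin_2pi n : cos ((pi : R) *+ 2 *+ n) = 1 /\ sin ((pi : R) *+ 2 *+ n) = 0.
Proof.
elim: n => [|n [c s]]; first by rewrite mulr0n cos0 sin0.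
by rewrite mulrSr cosD2pi sinD2pi.
Qed.

(** By cos d = 1 - 2 sin (d / 2) ^ 2. *)
Lemma cos_lt1 (d : R) : 0 < d < pi *+ 2 -> cos d < 1.
Proof.
move=> /andP[d0 d2].
have s0 : 0 < sin (d / 2).
  by apply: sin_gt0_pi; rewrite divr_gt0//= ltr_pdivrMr// mulr_natr.
have -> : d = d / 2 *+ 2 by rewrite -mulr_natr divfK// pnatr_eq0.
rewrite cos_mulr2n cos2sin2; have : 0 < sin (d / 2) ^+ 2 by rewrite exprn_gt0.
lra.
Qed.

End Complex.

Section Characters.
Variables (R : realType) (m : nat -> nat).
Hypothesis m_ge2 : forall k, (2 <= m k)%N.
Local Notation G := (vilenkin m).
Local Notation M := (M_ m).
Implicit Types x y : G.
Local Open Scope complex_scope.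

Lemma rademacher_root k (x : G) : rademacher R k x ^+ m k = 1.
Proof.
have mk : (m k)%:R != 0 :> R by rewrite pnatr_eq0; have := m_ge2 k; lia.
rewrite /rademacher cos_sin_exp.
have -> : 2 * pi * (x k)%:R / (m k)%:R *+ m k = (pi : R) *+ 2 *+ x k.
  by rewrite -mulr_natr divfK// mulr_natr [2 * _]mulrC mulr_natr.
by have [-> ->] := cos_sin_2pi R (x k).
Qed.

Definition char_ratio (x y : G) k : R[i] := rademacher R k x * (rademacher R k y)^*.

Lemma char_ratio_root x y k : char_ratio x y k ^+ m k = 1.
Proof. by rewrite exprMn -rmorphXn !rademacher_root rmorph1 mulr1. Qed.

Lemma char_ratio_sym x y k : char_ratio y x k = (char_ratio x y k)^*.
Proof.
rewrite /char_ratio; case: (rademacher R k x) (rademacher R k y) => a b [c d].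
by apply/eqP; rewrite eq_complex /=; apply/andP; split; apply/eqP; ring.
Qed.

Lemma char_ratio_neq1_lt x y k : (x k < y k)%N -> char_ratio x y k != 1.
Proof.
move=> xy; apply/eqP => /(congr1 (fun z => complex.Re z)).
rewrite /char_ratio /rademacher /=; set a := _ / _; set b := _ / _.
rewrite mulrN opprK => e.
have mk : 0 < (m k)%:R :> R by rewrite ltr0n; have := m_ge2 k; lia.
suff : cos (b - a) < 1.
  by rewrite cosB mulrC [sin b * _]mulrC e ltxx.
apply: cos_lt1; rewrite /a /b -mulrBl -mulrBr -natrB ?(ltnW xy)//.
have p0 : 0 < pi :> R by exact: pi_gt0.
rewrite !mulr_gt0 ?invr_gt0 ?ltr0n ?subn_gt0//=.
rewrite ltr_pdivrMr// -[pi *+ 2]mulr_natl ltr_pM2l ?mulr_gt0// ltr_nat.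
by have := ProductMeasure.xlt m_ge2 y k; lia.
by have := m_ge2 k; lia.
Qed.

Lemma char_ratio_neq1 x y k : x k != y k -> char_ratio x y k != 1.
Proof.
move=> xy; have [|yx|/val_inj e] := ltngtP (x k) (y k).
- exact: char_ratio_neq1_lt.
- rewrite char_ratio_sym; apply: contra (char_ratio_neq1_lt yx) => /eqP e.
  by rewrite -[char_ratio _ _ _]conjcK e conjc1.
- by rewrite e eqxx in xy.
Qed.

Lemma psi_ratio x y i : psi R i x * (psi R i y)^* = wchar m (char_ratio x y) i.
Proof.
rewrite /psi /wchar rmorph_prod -big_split; apply: eq_bigr => k _.
by rewrite rmorphXn exprMn.
Qed.

Lemma cylindrical_psi L i : (i < M L)%N -> cylindrical L (psi R (m := m) i).
Proof.
move=> iL x y xy; apply: eq_bigr => k _; have [kL|Lk] := ltnP k L.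
  by rewrite /rademacher xy.
by rewrite digit_small// (leq_trans iL)// M_le.
Qed.

End Characters.

(** * Partial sums of a martingale as finite sums *)

Section Martingale.
Variables (R : realType) (m : nat -> nat).
Hypothesis m_ge2 : forall k, (2 <= m k)%N.
Local Notation G := (vilenkin m).
Local Notation M := (M_ m).
Local Open Scope complex_scope.
Variables (mu : probability G R) (mu_product : is_product_measure mu).

(** The sets that are unions of cylinders of level N form a sigma-algebra. *)
Lemma F_saturated N (A : set G) : F_ N A ->
  forall x y : G, (forall k, (k < N)%N -> x k = y k) -> A x -> A y.
Proof.
move=> FA; apply: (FA (fun A : set G => forall x y : G,
  (forall k, (k < N)%N -> x k = y k) -> A x -> A y)); split.
  split=> //.
  - move=> B B_sat x y xy [_ Bx]; split=> // By; apply: Bx.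
    by apply: B_sat By => k kN; rewrite xy.
  - move=> B B_sat x y xy [n _ Bx]; exists n => //; exact: B_sat Bx.
move=> _ [z _ <-] x y xy xz k kN; by rewrite -xy// xz.
Qed.

(** Preimages of points under an adapted function are unions of cylinders. *)
Lemma martingale_cylindrical (f : nat -> G -> R[i]) N :
  martingale mu f -> cylindrical N (f N).
Proof.
move=> mf x y xy; apply/eqP; rewrite eq_complex.
have [FRe _] := martingale_adapted mf N (measurable_set1 (complex.Re (f N x))).
have [_ FIm] := martingale_adapted mf N (measurable_set1 (complex.Im (f N x))).
have -> : complex.Re (f N y) = complex.Re (f N x) by exact: (F_saturated FRe xy).
have -> : complex.Im (f N y) = complex.Im (f N x) by exact: (F_saturated FIm xy).
by rewrite !eqxx.
Qed.

Lemma cintegral_I N L (g : G -> R[i]) (x : digits m L) : (N <= L)%N ->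
  cylindrical L g ->
  cintegral mu (I_ N (extend x)) g =
    (M L)%:R^-1%:C * \sum_(y | agree N N x y) g (extend y).
Proof.
move=> NL gL; set A := I_ N (extend x).
have Acyl : cylindrical L A.
  move=> y z yz; apply/propext; split=> h k kN; rewrite -h//.
    by rewrite yz// (leq_trans kN).
  by rewrite yz// (leq_trans kN).
have memA (y : digits m L) : (extend y \in A) = agree N N x y.
  apply/idP/agreeP => [|xy]; rewrite ?inE.
    by move=> h k kN _; rewrite -!extendE h.
  move=> k kN; have kL := leq_trans kN NL.
  by rewrite !(extendE _ (Ordinal kL)) xy//= neq_ltn kN.
have part (u : G -> R) : cylindrical L u -> Rintegral mu A u =
    (M L)%:R^-1 * \sum_(y | agree N N x y) u (extend y).
  move=> uL; rewrite Rintegral_mkcond (@cylindrical_Rintegral _ _ _ mu_product L).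
    rewrite [in RHS]big_mkcond; congr (_ * _); apply: eq_bigr => y _.
    by rewrite patchE memA.
  move=> y z yz; rewrite !patchE (uL _ _ yz).
  by have -> : (y \in A) = (z \in A) by apply/idP/idP; rewrite !in_setE (Acyl _ _ yz).
rewrite /cintegral !part.
- apply/eqP; rewrite eq_complex Re_scale Im_scale Re_sum Im_sum.
  by rewrite !eqxx.
- by move=> y z yz; rewrite (gL _ _ yz).
- by move=> y z yz; rewrite (gL _ _ yz).
Qed.

Lemma cintegral_cylindrical L (g : G -> R[i]) : cylindrical L g ->
  cintegral mu setT g = (M L)%:R^-1%:C * \sum_(y : digits m L) g (extend y).
Proof.
move=> gL; pose x : digits m L := trunc L (fun k => 0).
have -> : [set: G] = I_ 0 (extend x) by apply/seteqP; split.
rewrite cintegral_I//; congr (_ * _); apply: eq_bigl => y.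
by apply/agreeP.
Qed.

Lemma martingale_class_sum (f : nat -> G -> R[i]) N L (x : digits m L) :
  martingale mu f -> (N <= L)%N ->
  \sum_(y | agree N N x y) f L (extend y) =
  \sum_(y : digits m L | agree N N x y) f N (extend y).
Proof.
move=> mf NL.
have FI : F_ N (I_ N (extend x)) by apply: sub_sigma_algebra; exists (extend x).
have fN := cylindrical_widen NL (martingale_cylindrical mf (N := N)).
have := martingale_cond mf NL FI.
rewrite !(@cintegral_I _ L)//; last exact: martingale_cylindrical.
apply: mulfI; rewrite eq_complex /= eqxx andbT invr_eq0 pnatr_eq0.
by have := M_gt0 m_ge2 L; lia.
Qed.

(** Summing over all classes counts every point equally often, and a
    function u of N coordinates is constant on each class. *)
Lemma eq_sum_class L N (a b u : digits m L -> R[i]) : (N <= L)%N ->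
  determined N u ->
  (forall x, \sum_(y | agree N N x y) a y = \sum_(y | agree N N x y) b y) ->
  \sum_y a y * u y = \sum_y b y * u y.
Proof.
move=> NL uN ab.
have c (x : digits m L) : #|[pred y | agree N N x y]| = (M L %/ M N)%N.
  by have := card_agree m_ge2 N x NL; rewrite ltnn muln1 => <-; rewrite mulnK// M_gt0.
have cpos : (0 < M L %/ M N)%N by rewrite divn_gt0 ?M_le ?M_gt0.
have H (v : digits m L -> R[i]) : (\sum_y v y * u y) *+ (M L %/ M N) =
    \sum_x u x * \sum_(y | agree N N x y) v y.
  rewrite -sumrMnl; under [RHS]eq_bigr do rewrite mulr_sumr.
  rewrite (exchange_big_dep predT)//=; apply: eq_bigr => y _.
  rewrite (eq_bigr (fun=> v y * u y)); last first.
    by move=> x xy; rewrite (uN x y xy) mulrC.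
  rewrite sumr_const -(c y); congr (_ *+ _); apply: eq_card => x.
  by rewrite !inE agree_sym.
apply: (mulfI (x := (M L %/ M N)%:R)); first by rewrite pnatr_eq0 -lt0n.
by rewrite !mulr_natl !H; apply: eq_bigr => x _; rewrite ab.
Qed.

(** By the martingale property the integrals defining the coefficient are
    constant from level N on, where the character is determined by N
    coordinates, so the limit is the integral at level N. *)
Lemma fourier_coefE (f : nat -> G -> R[i]) i N L : martingale mu f ->
  (i < M N)%N -> (N <= L)%N ->
  fourier_coef mu f i =
  (M L)%:R^-1%:C * \sum_(y : digits m L) f N (extend y) * (psi R i (extend y))^*.
Proof.
move=> mf iN NL; have fc n := martingale_cylindrical mf (N := n).
have psiN := cylindrical_psi R m_ge2 iN.
have cyl K (g : G -> R[i]) : (N <= K)%N -> cylindrical K g ->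
    cylindrical K (fun x => g x * (psi R i x)^*).
  move=> NK gK x y xy; rewrite (gK _ _ xy).
  by rewrite (cylindrical_widen NK psiN xy).
pose c k := cintegral mu setT (fun x => f k x * (psi R i x)^*).
have stable k : (N <= k)%N -> c k = c N.
  move=> Nk; rewrite /c (cintegral_cylindrical (cyl k (f k) Nk (fc k))).
  have cN := cyl k (f N) Nk (cylindrical_widen Nk (fc N)).
  rewrite (cintegral_cylindrical cN); congr *%R => /=.
  apply: (@eq_sum_class k N (fun y => f k (extend y)) (fun y => f N (extend y))
     (fun y => (psi R i (extend y))^*)) => //.
    by move=> x y xy; rewrite (determined_extend psiN xy).
  by move=> x; exact: martingale_class_sum.
have cN := cyl L (f N) NL (cylindrical_widen NL (fc N)).
rewrite -(cintegral_cylindrical cN) -/(c N) /fourier_coef -/c.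
have lim_const (u : nat -> R) (l : R) : (forall k, (N <= k)%N -> u k = l) -> limn u = l.
  move=> ul; apply: norm_lim_near_cst; near=> k; apply: ul; near: k.
  exact: nbhs_infty_ge.
rewrite (lim_const _ (complex.Re (c N))); last first.
  by move=> k Nk; rewrite -[cintegral _ _ _]/(c k) stable.
rewrite (lim_const _ (complex.Im (c N))); last first.
  by move=> k Nk; rewrite -[cintegral _ _ _]/(c k) stable.
by case: (c N).
Unshelve. all: by end_near. Qed.

Lemma cylindrical_partial_sum f n L : (n <= M L)%N ->
  cylindrical L (partial_sum mu f n).
Proof.
move=> nL x y xy; apply: eq_bigr => i _.
by rewrite (cylindrical_psi R m_ge2 (leq_trans (ltn_ord i) nL) xy).
Qed.

Lemma cylindrical_riesz_mean f n L : (n < M L)%N ->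
  cylindrical L (riesz_mean mu f n).
Proof.
move=> nL x y xy; rewrite /riesz_mean.
suff e : \sum_(1 <= k < n.+1) partial_sum mu f k x / k%:R =
         \sum_(1 <= k < n.+1) partial_sum mu f k y / k%:R by rewrite e.
apply: eq_big_nat => k /andP[_ kn].
by rewrite (cylindrical_partial_sum f (leq_trans (ltnW kn) nL) xy).
Qed.

Lemma sum_partial_sumE (f : nat -> G -> R[i]) n N L (x : G) : martingale mu f ->
  (n < M N)%N -> (N <= L)%N ->
  \sum_(1 <= k < n.+1) partial_sum mu f k x = (M L)%:R^-1%:C *
    \sum_(y : digits m L) f N (extend y) * fejer_sum m (char_ratio R x (extend y)) n.+1.
Proof.
move=> mf nN NL.
have pk k : (k < n.+1)%N -> partial_sum mu f k x = (M L)%:R^-1%:C *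
    \sum_(y : digits m L) f N (extend y) * dirichlet m (char_ratio R x (extend y)) k.
  move=> kn; rewrite /partial_sum /dirichlet /psum.
  under [in RHS]eq_bigr do rewrite mulr_sumr.
  rewrite exchange_big mulr_sumr; apply: eq_bigr => i _ /=.
  rewrite (fourier_coefE mf _ NL); last first.
    by have := ltn_ord i; lia.
  rewrite -mulrA mulr_suml; congr *%R; apply: eq_bigr => y _.
  by rewrite -psi_ratio -mulrA [X in _ * X]mulrC.
rewrite /fejer_sum /psum.
under [in RHS]eq_bigr do rewrite mulr_sumr.
rewrite exchange_big mulr_sumr /=.
rewrite -(big_mkord predT (fun k => (M L)%:R^-1%:C * \sum_(y : digits m L)
   f N (extend y) * dirichlet m (char_ratio R x (extend y)) k)).
rewrite [in RHS]big_ltn// [in RHS]big1 ?mulr0 ?add0r.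
  by rewrite !big_nat; apply: eq_bigr => k /andP[_ kn]; exact: pk.
by move=> y _; rewrite /dirichlet /psum big_ord0 mulr0.
Qed.

End Martingale.

(** * From Fejer means to Riesz means *)

Section Riesz.
Variable R : realType.
Local Open Scope complex_scope.

Lemma log_weight_gt0 n : (0 < n)%N -> 0 < log_weight R n.
Proof.
move=> n0; rewrite /log_weight big_ltn// ltr_pwDl ?invr_gt0//.
by rewrite big_nat; apply: sumr_ge0 => k _; rewrite invr_ge0.
Qed.

(** The form of Abel's transformation that goes through by induction on n. *)
Lemma abel_summation (S : nat -> R[i]) n :
  \sum_(1 <= k < n.+1) S k / k%:R =
  (n.+1%:R^-1 : R)%:C * (\sum_(1 <= j < n.+1) S j) +
  \sum_(1 <= k < n.+1) (k%:R^-1 - k.+1%:R^-1 : R)%:C * \sum_(1 <= j < k.+1) S j.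
Proof.
elim: n => [|n IH]; first by rewrite !big_geq// mulr0 addr0.
rewrite big_nat_recr//= IH [in RHS]big_nat_recr//= [X in _ = _ + X]big_nat_recr//=.
rewrite [X in _ = _ + (_ + _ * X)]big_nat_recr//=.
have -> : (n.+1%:R : R[i])^-1 = (n.+1%:R^-1 : R)%:C by rewrite fmorphV rmorph_nat.
rewrite rmorphB/=; ring.
Qed.

(** The Riesz means are averages of the Fejer means: after Abel summation the
    coefficients of the Fejer means are nonnegative and add up to log_weight n. *)
Lemma log_mean_le (S : nat -> R[i]) n (s : R) :
  (forall k, (0 < k <= n)%N -> Normc.normc (\sum_(1 <= j < k.+1) S j) <= k%:R * s) ->
  Normc.normc (\sum_(1 <= k < n.+1) S k / k%:R) <= log_weight R n * s.
Proof.
case: n => [|n] hS; first by rewrite /log_weight !big_geq// Normc.normc0 mul0r.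
rewrite abel_summation; apply: le_trans (le_normcD _ _) _.
have -> : log_weight R n.+1 * s = n.+2%:R^-1 * (n.+1%:R * s) +
   \sum_(1 <= k < n.+2) (k%:R^-1 - k.+1%:R^-1) * (k%:R * s).
  rewrite /log_weight; elim: n {hS} => [|n IH].
    by rewrite !big_nat1; field.
  rewrite big_nat_recr//= [in RHS]big_nat_recr//= mulrDl IH.
  by field; rewrite -!natrD !pnatr_eq0.
apply: lerD.
  rewrite Normc.normcM normc_real ?invr_ge0// ler_wpM2l ?invr_ge0//.
  by apply: hS; rewrite leqnn.
apply: le_trans (normc_sum _ _ _) _.
rewrite !big_nat; apply: ler_sum => k /andP[k0 kn].
have c0 : 0 <= k%:R^-1 - k.+1%:R^-1 :> R.
  by rewrite subr_ge0 lef_pV2 ?posrE ?ltr0n// ler_nat.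
rewrite Normc.normcM normc_real// ler_wpM2l//.
by apply: hS; rewrite k0.
Qed.

End Riesz.

(** * Riesz means of a martingale bounded by its running maxima *)

Section MartingaleBound.
Variables (R : realType) (m : nat -> nat) (B : nat).
Hypothesis m_ge2 : forall k, (2 <= m k)%N.
Hypothesis m_leB : forall k, (m k <= B)%N.
Local Notation G := (vilenkin m).
Local Notation M := (M_ m).
Local Notation MR n := ((M n)%:R : R).
Local Open Scope complex_scope.

Lemma first_below (P : pred nat) a N :
  (forall k, (a <= k < N)%N -> ~~ P k) \/
  exists t, [/\ (a <= t < N)%N, P t & forall k, (a <= k < t)%N -> ~~ P k].
Proof.
have [ex|no] := pselect (exists k, (a <= k < N)%N && P k).
  right; case: (ex_minnP ex) => t /andP[atN Pt] t_min; exists t; split=> // k akt.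
  apply/negP => Pk; have := t_min k; rewrite Pk andbT; lia.
left=> k akN; apply/negP => Pk; apply: no; exists k; exact/andP.
Qed.

Lemma M_succ_le k : (M k.+1 <= B * M k)%N.
Proof. by rewrite M_S mulnC leq_mul2r m_leB orbT. Qed.

(** Take for t and A the first two coordinates below N at which x and y
    differ, or N itself when there is none left. *)
Lemma fejer_sum_le L N n (x y : digits m L) : (N <= L)%N -> (n <= M N)%N ->
  exists A t, [/\ (t <= A <= N)%N, agree A t x y &
    Normc.normc (fejer_sum m (char_ratio R (extend x) (extend y)) n) <=
      (B * B * (M t * M A))%:R].
Proof.
move=> NL nN; set w := char_ratio _ _ _.
have w1 k : w k ^+ m k = 1 by exact: char_ratio_root.
have nc z j k : `|z| <= j%:R :> R[i] -> (j <= k)%N -> Normc.normc z <= k%:R :> R.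
  move=> zj jk; rewrite normc_le rmorph_nat (le_trans zj)// ler_nat.
  exact: jk.
have B1 : (1 <= B)%N by have := m_ge2 0; have := m_leB 0; lia.
pose P k := extend x k != extend y k.
have wP k : P k -> w k != 1 by exact: char_ratio_neq1.
have agr A t : (A <= N)%N -> (forall k, (k < A)%N -> k != t -> ~~ P k) -> agree A t x y.
  move=> AN xy; apply/agreeP => k kA kt; rewrite -!extendE; apply/eqP.
  by have := xy k kA kt; rewrite negbK.
have [none|[t [/andP[_ tN] Pt t_min]]] := first_below P 0 N.
  exists N, N; split; first by rewrite leqnn.
    by apply: agr => // k kN _; apply: none.
  apply: nc (norm_fejer_sum0 m_ge2 w1 n) _.
  apply: leq_trans (leq_mul nN nN) _.
  by rewrite leq_pmull// muln_gt0 B1.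
have [none|[A [/andP[tA AN] PA A_min]]] := first_below P t.+1 N.
  exists N, t; split; first by rewrite (ltnW tN) leqnn.
    apply: agr => // k kN kt; have [kt'|tk'|e] := ltngtP k t; last by rewrite e eqxx in kt.
      exact: t_min.
    by apply: none; rewrite tk'.
  apply: nc (norm_fejer_sum1 m_ge2 w1 n (wP _ Pt)) _.
  apply: leq_trans (leq_mul nN (M_succ_le t)) _.
  by rewrite mulnCA [(M N * _)%N]mulnC -mulnA leq_pmull.
exists A, t; split; first by rewrite (ltnW tA) (ltnW AN).
  apply: agr; first exact: ltnW.
  move=> k kA kt; have [kt'|tk'|e] := ltngtP k t; last by rewrite e eqxx in kt.
    exact: t_min.
  by apply: A_min; rewrite tk'.
apply: nc (norm_fejer_sum2 m_ge2 w1 n tA (wP _ Pt) (wP _ PA)) _.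
apply: leq_trans (leq_mul (M_succ_le A) (M_succ_le t)) _.
by rewrite mulnACA [(M A * _)%N]mulnC.
Qed.

Variables (mu : probability G R) (mu_product : is_product_measure mu).
Variables (f : nat -> G -> R[i]) (mf : martingale mu f).
Let absf n (x : G) : R := Normc.normc (f n x).

Lemma sum_partial_sum_le L N n (x : digits m L) : (N <= L)%N -> (n < M N)%N ->
  Normc.normc (\sum_(1 <= k < n.+1) partial_sum mu f k (extend x)) <=
  (B * B * M N)%:R * scale_sum N (fun y => absf N (extend y)) x.
Proof.
move=> NL nN; rewrite (sum_partial_sumE m_ge2 mu_product _ mf nN NL).
rewrite Normc.normcM normc_real ?invr_ge0//.
apply: (@le_trans _ _ ((MR L)^-1 * \sum_y absf N (extend y) *
  \sum_(i : 'I_L.+1 * 'I_L.+1 | (i.2 <= i.1 <= N)%N && agree i.1 i.2 x y)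
    (B * B * (M i.2 * M i.1))%:R)).
  rewrite ler_wpM2l ?invr_ge0//; apply: le_trans (normc_sum _ _ _) _.
  apply: ler_sum => y _; rewrite Normc.normcM ler_wpM2l ?normc_ge0//.
  have [A [t [/andP[tA AN] xy]]] := fejer_sum_le x y NL nN.
  move/le_trans; apply.
  have AL : (A < L.+1)%N by rewrite ltnS (leq_trans AN).
  have tL : (t < L.+1)%N by rewrite (leq_ltn_trans tA).
  rewrite (bigD1 (Ordinal AL, Ordinal tL))/=; last by rewrite tA AN xy.
  by rewrite lerDl sumr_ge0.
rewrite /scale_sum mulr_sumr mulr_sumr.
under eq_bigr do rewrite mulrCA mulr_sumr.
under eq_bigr do rewrite mulr_sumr.
rewrite (exchange_big_dep (fun i : 'I_L.+1 * 'I_L.+1 => (i.2 <= i.1 <= N)%N))/=; last first.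
  by move=> y i _ /andP[].
apply: ler_sum => i iN; rewrite /smear !mulr_sumr iN /=.
apply: ler_sum => y _; rewrite !natrM le_eqVlt; apply/orP; left; apply/eqP.
by field; rewrite !gt_eqF ?MR_gt0.
Qed.

(** The least N with n < M N; minimality and m k <= B make M N and n
    comparable. *)
Lemma level_of n L : (0 < n)%N -> (n < M L)%N ->
  exists N, [/\ (N <= L)%N, (n < M N)%N & (M N <= B * n)%N].
Proof.
move=> n0 nL; have ex : exists N, (n < M N)%N by exists L.
case: (ex_minnP ex) => N nN N_min; exists N; split=> //; first exact: N_min.
case: N nN N_min => [|N] nN N_min; first by move: nN; rewrite /M_ big_ord0; lia.
apply: leq_trans (M_succ_le N) _; rewrite leq_mul2l leqNgt; apply/orP; right.
by apply/negP => /N_min; rewrite ltnn.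
Qed.

Definition running_max (a : nat -> G -> R) L (x : G) : R :=
  \big[Order.max/0]_(n < L) a n x.

Lemma running_max_ge0 a L x : 0 <= running_max a L x.
Proof. exact: bigmax_ge_id. Qed.

Lemma le_running_max a L n x : (n < L)%N -> a n x <= running_max a L x.
Proof.
move=> nL.
by exact: (le_bigmax_cond _ (fun i : 'I_L => a i x) (j := Ordinal nL)).
Qed.

Lemma running_max_le a L x s : 0 <= s -> (forall n, (n < L)%N -> a n x <= s) ->
  running_max a L x <= s.
Proof. by move=> s0 h; apply: bigmax_le => // i _; exact: h. Qed.

Lemma running_max_homo a K L x : (K <= L)%N -> running_max a K x <= running_max a L x.
Proof.
move=> KL; apply: running_max_le; first exact: running_max_ge0.
by move=> n nK; apply: le_running_max; apply: leq_trans KL.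
Qed.

Lemma running_max_cylindrical a K L :
  (forall n, (n < K)%N -> cylindrical L (a n)) -> cylindrical L (running_max a K).
Proof. by move=> h x y xy; apply: eq_bigr => i _; exact: (h i). Qed.

Let riesz n (x : G) : R := Normc.normc (riesz_mean mu f n x).

(** Every Fejer mean entering the Riesz means of index below M L is bounded by
    scale_sum at a level N <= L, and the majorant dominates all these levels at
    once. *)
Lemma riesz_running_max_le (p : R) L eta K (x : digits m L) : 0 < p -> 0 < K ->
  0 < eta < 1 ->
  (forall N (h : digits m L -> R) x, (N <= L)%N -> (forall y, 0 <= h y) ->
     determined N h ->
     (scale_sum N h x) `^ p <= K * geo_sum eta N (fun y => h y `^ p) x) ->
  running_max riesz (M L) (extend x) `^ p <=
  (B ^ 3)%:R `^ p * K *
    majorant B eta (fun n y => running_max absf n.+1 (extend y) `^ p) x.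
Proof.
move=> p0 K0 eta01 scale_le.
(* Taking p-th powers of running maxima makes F nondecreasing in n. *)
pose F n (y : digits m L) := running_max absf n.+1 (extend y) `^ p.
have F0 n y : 0 <= F n y by exact: powR_ge0.
have Fnd n y : F n y <= F n.+1 y.
  by rewrite ge0_ler_powR ?nnegrE ?running_max_ge0 ?(ltW p0) ?running_max_homo.
have Fdet n : determined n (F n).
  apply: (determined_extend (g := fun z => running_max absf n.+1 z `^ p)).
  move=> a b ab; congr (_ `^ _).
  apply: (running_max_cylindrical (a := absf) (K := n.+1) _ ab) => k kn c d cd.
  congr (Normc.normc _); apply: (martingale_cylindrical mf) => j jk.
  by apply: cd; apply: leq_trans jk kn.
have geo_le N : (N <= L)%N -> geo_sum eta N (F N) x <= majorant B eta F x.
  exact: (geo_sum_le_majorant m_ge2 m_leB eta01 F0 Fnd Fdet).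
set Maj := majorant _ _ _ _ in geo_le *.
have Maj0 : 0 <= Maj.
  by apply: le_trans (geo_le 0 (leq0n L)); exact: geo_sum_ge0.
have scale_le' N : (N <= L)%N ->
    scale_sum N (fun y => absf N (extend y)) x <= (K * Maj) `^ p^-1.
  move=> NL; set V := scale_sum _ _ _.
  have V0 : 0 <= V by apply: scale_sum_ge0 => y; exact: normc_ge0.
  rewrite -(@powRr1 _ V)// -(@mulfV _ p) ?gt_eqF// powRrM.
  rewrite ge0_ler_powR ?nnegrE ?powR_ge0 ?invr_ge0 ?(ltW p0) ?mulr_ge0 ?(ltW K0)//.
  apply: le_trans (scale_le N _ x NL _ _) _.
  - by move=> y; exact: normc_ge0.
  - apply: (determined_extend (g := absf N)) => a b ab.
    by rewrite /absf (martingale_cylindrical mf ab).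
  rewrite ler_wpM2l ?(ltW K0)//; apply: le_trans (geo_le N NL).
  apply: ler_sum => i _; rewrite ler_wpM2l ?mulr_ge0 ?geo_ge0//.
  apply: le_smear => y _.
  rewrite ge0_ler_powR ?nnegrE ?normc_ge0 ?running_max_ge0 ?(ltW p0)//.
  exact: le_running_max.
have s0 : 0 <= (B ^ 3)%:R * (K * Maj) `^ p^-1 by rewrite mulr_ge0 ?powR_ge0.
have : running_max riesz (M L) (extend x) <= (B ^ 3)%:R * (K * Maj) `^ p^-1.
  apply: running_max_le => // n nL; rewrite /riesz /riesz_mean.
  case: n nL => [|n] nL.
    by rewrite [X in _ * X]big_geq// mulr0 Normc.normc0.
  rewrite Normc.normcM normc_real ?invr_ge0 ?(ltW (log_weight_gt0 _ _))//.
  rewrite mulrC ler_pdivrMr ?log_weight_gt0// mulrC.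
  apply: log_mean_le => k /andP[k0 kn].
  have [N [NL kN NB]] := level_of k0 (leq_ltn_trans kn nL).
  apply: le_trans (sum_partial_sum_le x NL kN) _.
  rewrite mulrA; apply: ler_pM => //; last exact: scale_le'.
    by apply: scale_sum_ge0 => y; exact: normc_ge0.
  rewrite -natrM ler_nat (_ : k * B ^ 3 = B * B * (B * k))%N.
    by rewrite leq_mul2l NB orbT.
  by rewrite !expnS expn0; lia.
move=> H; apply: (@le_trans _ _ (((B ^ 3)%:R * (K * Maj) `^ p^-1) `^ p)).
  by rewrite ge0_ler_powR ?nnegrE ?running_max_ge0 ?(ltW p0).
rewrite powRM ?powR_ge0// -powRrM mulVf ?gt_eqF// powRr1 ?mulr_ge0 ?(ltW K0)//.
by rewrite mulrA.
Qed.

End MartingaleBound.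

(** * Monotone passage to the supremum *)

Section MonotoneConvergence.
Local Open Scope ereal_scope.
Context (d : measure_display) (T : measurableType d) (R : realType).
Variable mu : {measure set T -> \bar R}.

Lemma poweR_ereal_sup (p : R) (u : nat -> R) : (0 < p)%R -> (forall n, 0 <= u n)%R ->
  `|ereal_sup (range (fun n => (u n)%:E))| `^ p =
  ereal_sup (range (fun n => (u n `^ p)%:E)).
Proof.
move=> p0 u0; set S := ereal_sup _.
have uS n : (u n)%:E <= S by apply: ereal_sup_ubound; exists n.
have S0 : 0 <= S by apply: le_trans (uS 0%N); rewrite lee_fin.
have dom (x : \bar R) : 0 <= x -> x \in `[0, +oo%E]%R.
  by move=> x0; rewrite in_itv/= x0 leey.
rewrite gee0_abs//; apply/eqP; rewrite eq_le; apply/andP; split; last first.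
  apply: ge_ereal_sup => _ [n _ <-]; rewrite -poweR_EFin.
  by apply: gt0_ler_poweR (uS n); rewrite ?(ltW p0)//; apply: dom; rewrite ?lee_fin.
set Z := ereal_sup _.
have uZ n : (u n `^ p)%:E <= Z by apply: ereal_sup_ubound; exists n.
have Z0 : 0 <= Z by apply: le_trans (uZ 0%N); rewrite lee_fin powR_ge0.
have SZ : S <= Z `^ p^-1.
  apply: ge_ereal_sup => _ [n _ <-].
  have -> : (u n)%:E = (u n `^ p)%:E `^ p^-1.
    by rewrite poweR_EFin -powRrM mulfV ?gt_eqF// powRr1.
  apply: gt0_ler_poweR (uZ n); rewrite ?invr_ge0 ?(ltW p0)//; apply: dom => //.
  by rewrite lee_fin powR_ge0.
have -> : Z = (Z `^ p^-1) `^ p by rewrite -poweRrM mulVf ?gt_eqF// poweRe1.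
by apply: gt0_ler_poweR SZ; rewrite ?(ltW p0)//; apply: dom; rewrite ?poweR_ge0.
Qed.

Lemma integral_sup_pow (p : R) (A : nat -> T -> R) : (0 < p)%R ->
  (forall n, measurable_fun setT (A n)) -> (forall n x, 0 <= A n x)%R ->
  (forall n k x, (n <= k)%N -> A n x <= A k x)%R ->
  \int[mu]_x `|ereal_sup (range (fun n => (A n x)%:E))| `^ p =
  ereal_sup (range (fun n => \int[mu]_x (A n x `^ p)%:E)).
Proof.
move=> p0 mA A0 A_homo.
have pow_homo n k x : (n <= k)%N -> ((A n x `^ p)%:E <= (A k x `^ p)%:E)%E.
  move=> nk; rewrite lee_fin ge0_ler_powR ?nnegrE ?(ltW p0)//.
  exact: A_homo.
have mAp n : measurable_fun setT (fun x => (A n x `^ p)%:E).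
  apply/measurable_EFinP.
  exact: (measurableT_comp (measurable_powR p) (mA n)).
transitivity (\int[mu]_x limn (fun n => (A n x `^ p)%:E)).
  apply: eq_integral => x _; rewrite poweR_ereal_sup//.
  apply/esym/cvg_lim => //; apply: ereal_nondecreasing_cvgn => n k nk.
  exact: pow_homo.
rewrite (monotone_convergence mu measurableT mAp)//.
- apply/cvg_lim => //; apply: ereal_nondecreasing_cvgn => n k nk.
  apply: ge0_le_integral => //.
  + by move=> x _; rewrite lee_fin powR_ge0.
  + by move=> x _; exact: pow_homo.
- by move=> n x _; rewrite lee_fin powR_ge0.
- by move=> x _ n k nk; exact: pow_homo.
Qed.

Lemma ereal_sup_cofinal (I : Type) (D : set I) (a : I -> R) (A : nat -> R) :
  (forall i, D i -> exists n, a i <= A n)%R ->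
  (forall n, (exists2 i, D i & A n <= a i)%R) ->
  ereal_sup [set (a i)%:E | i in D] = ereal_sup (range (fun n => (A n)%:E)).
Proof.
move=> aA Aa; apply/eqP; rewrite eq_le; apply/andP; split.
  apply: ge_ereal_sup => _ [i Di <-]; have [n an] := aA i Di.
  by apply: (@le_trans _ _ (A n)%:E); [rewrite lee_fin|apply: ereal_sup_ubound; exists n].
apply: ge_ereal_sup => _ [n _ <-]; have [i Di an] := Aa n.
by apply: (@le_trans _ _ (a i)%:E); [rewrite lee_fin|apply: ereal_sup_ubound; exists i].
Qed.
End MonotoneConvergence.

(** * The maximal inequality *)

Section MaximalInequality.
Variables (R : realType) (m : nat -> nat) (B : nat).
Hypothesis m_ge2 : forall k, (2 <= m k)%N.
Hypothesis m_leB : forall k, (m k <= B)%N.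
Local Notation G := (vilenkin m).
Local Notation M := (M_ m).
Variables (mu : probability G R) (mu_product : is_product_measure mu).

(** The finite inequality read as one between integrals; its constant does not
    depend on the level L. *)
Lemma riesz_running_max_pow (p : R) : 2^-1 < p -> exists C : R, 0 < C /\
  forall f L, martingale mu f ->
    (\int[mu]_x
       (running_max (fun n x => Normc.normc (riesz_mean mu f n x)) (M L) x `^ p)%:E
     <= C%:E *
        \int[mu]_x (running_max (fun n x => Normc.normc (f n x)) L.+1 x `^ p)%:E)%E.
Proof.
move=> p12; have p0 : 0 < p by apply: lt_trans p12; rewrite invr_gt0.
have [eta [K [eta01 K0 scale_le]]] := @scale_sum_pow R m B m_ge2 m_leB p p12.
have B0 : 0 < B%:R :> R by apply: lt_le_trans (B_ge1 R m_ge2 m_leB).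
have gam0 : 0 < (1 - eta)^-1 by rewrite invr_gt0 subr_gt0; case/andP: eta01.
exists ((B ^ 3)%:R `^ p * K *
  (B%:R * (1 - eta)^-1 ^+ 2 + B%:R * (1 - eta)^-1 ^+ 3)); split.
  by rewrite !mulr_gt0 ?powR_gt0 ?natrX ?exprn_gt0 ?addr_gt0 ?mulr_gt0 ?exprn_gt0.
move=> f L mf.
have fcyl n : (n < L.+1)%N -> cylindrical L (fun x => Normc.normc (f n x)).
  move=> nL; apply: (cylindrical_widen (N := n)) => // x y xy.
  by rewrite (martingale_cylindrical mf xy).
have rcyl n : (n < M L)%N -> cylindrical L (fun x => Normc.normc (riesz_mean mu f n x)).
  by move=> nL x y xy; rewrite ?/r (cylindrical_riesz_mean m_ge2 mu f nL xy).
have rI := cylindrical_integral mu_product (L := L)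
  (g := fun x => running_max (fun n x => Normc.normc (riesz_mean mu f n x)) (M L) x `^ p).
have fI := cylindrical_integral mu_product (L := L)
  (g := fun x => running_max (fun n x => Normc.normc (f n x)) L.+1 x `^ p).
rewrite rI; last by move=> x y xy; rewrite (running_max_cylindrical rcyl xy).
rewrite fI; last by move=> x y xy; rewrite (running_max_cylindrical fcyl xy).
rewrite -EFinM lee_fin mulrCA ler_wpM2l ?invr_ge0//.
pose F n (y : digits m L) :=
  running_max (fun n x => Normc.normc (f n x)) n.+1 (extend y) `^ p.
apply: (@le_trans _ _ (\sum_(x : digits m L) (B ^ 3)%:R `^ p * K * majorant B eta F x)).
  apply: ler_sum => x _.
  exact: (riesz_running_max_le m_ge2 m_leB mu_product mf x p0 K0 eta01 (scale_le L)).
rewrite -mulr_sumr -[leRHS]mulrA ler_wpM2l ?mulr_ge0 ?powR_ge0 ?(ltW K0)//.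
apply: (sum_majorant (F := F) m_ge2 m_leB eta01).
- by move=> n x; exact: powR_ge0.
- move=> n x; rewrite ge0_ler_powR ?nnegrE ?running_max_ge0 ?(ltW p0)//.
  exact: running_max_homo.
Qed.

End MaximalInequality.

Theorem theorem1 (R : realType) (m : nat -> nat)
    (m_ge2 : forall k, (2 <= m k)%N)
    (m_bounded : exists B : nat, forall k, (m k <= B)%N)
    (mu : probability (vilenkin m) R) (mu_product : is_product_measure mu)
    (p : R) (p_gt_half : 1 / 2 < p) :
  exists c : R, 0 < c /\
    forall f : nat -> vilenkin m -> R[i], hardy_space mu p f ->
      ('N[mu]_p%:E [riesz_maximal mu f] <= c%:E * hardy_norm mu p f)%E.
Proof.
have [B m_leB] := m_bounded.
have p12 : 2^-1 < p by rewrite -[2^-1]mul1r.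
have p0 : 0 < p by apply: lt_trans p12; rewrite invr_gt0.
have [C [C0 maxC]] := riesz_running_max_pow m_ge2 m_leB mu_product p12.
exists (C `^ p^-1); split; first exact: powR_gt0.
move=> f [mf _]; rewrite /hardy_norm unlock /=.
pose a n x : R := Normc.normc (f n x).
pose r n x : R := Normc.normc (riesz_mean mu f n x).
have max_attained (u : nat -> vilenkin m -> R) L x :
    (forall n, 0 <= u n x) -> (0 < L)%N ->
    exists2 n, (n < L)%N & running_max u L x <= u n x.
  move=> u0; case: L => // L _.
  case: (@arg_maxP _ _ _ ord0 predT (fun i : 'I_L.+1 => u i x) isT) => j _ h.
  by exists j => //; apply: running_max_le => // n nL; exact: (h (Ordinal nL)).
(* The running maximum includes the index 0, which the supremum defining
   riesz_maximal excludes. *)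
have r0 x : r 0%N x = 0.
  by rewrite /r /riesz_mean [X in _ * X]big_geq// mulr0 Normc.normc0.
have maxE x : maximal_function f x =
    ereal_sup (range (fun L => (running_max a L.+1 x)%:E)).
  apply: ereal_sup_cofinal => [n _|L].
    by exists n; exact: (le_running_max a).
  have [n _ h] := max_attained a L.+1 x (fun n => normc_ge0 _) isT.
  by exists n.
have rieszE x : riesz_maximal mu f x =
    ereal_sup (range (fun L => (running_max r (M_ m L) x)%:E)).
  apply: ereal_sup_cofinal => [n n0|L].
    by exists n; apply: (le_running_max r); exact: M_gt.
  have [[|n] _ h] := max_attained r (M_ m L) x (fun n => normc_ge0 _) (M_gt0 m_ge2 L).
    by exists 1%N => //; rewrite (le_trans h)// r0 normc_ge0.
  by exists n.+1.
have acyl L n : (n < L.+1)%N -> cylindrical L (a n).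
  move=> nL; apply: (cylindrical_widen (N := n)) => // x y xy.
  by rewrite /a (martingale_cylindrical mf xy).
have rcyl L n : (n < M_ m L)%N -> cylindrical L (r n).
  by move=> nL x y xy; rewrite ?/r (cylindrical_riesz_mean m_ge2 mu f nL xy).
have -> : (\int[mu]_x `|riesz_maximal mu f x| `^ p)%E =
    ereal_sup (range (fun L => \int[mu]_x (running_max r (M_ m L) x `^ p)%:E)%E).
  under eq_integral do rewrite rieszE.
  apply: (integral_sup_pow mu (A := fun L => running_max r (M_ m L))) => //.
  - move=> L; apply: (measurable_cylindrical (L := L)).
    by apply: running_max_cylindrical => n; exact: rcyl.
  - by move=> L x; exact: running_max_ge0.
  - by move=> L L' x LL'; apply: running_max_homo; exact: M_le.
have -> : (\int[mu]_x `|maximal_function f x| `^ p)%E =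
    ereal_sup (range (fun L => \int[mu]_x (running_max a L.+1 x `^ p)%:E)%E).
  under eq_integral do rewrite maxE.
  apply: (integral_sup_pow mu (A := fun L => running_max a L.+1)) => //.
  - move=> L; apply: (measurable_cylindrical (L := L)).
    by apply: running_max_cylindrical => n; exact: acyl.
  - by move=> L x; exact: running_max_ge0.
  - by move=> L L' x LL'; apply: running_max_homo.
set I := ereal_sup _; set J := ereal_sup _.
have int0 (u : nat -> vilenkin m -> R) L :
    (0 <= \int[mu]_x (running_max u L x `^ p)%:E)%E.
  by apply: integral_ge0 => x _; rewrite lee_fin powR_ge0.
have J0 : (0 <= J)%E.
  by apply: le_trans (int0 a 1%N) _; apply: ereal_sup_ubound; exists 0%N.
have I0 : (0 <= I)%E.
  by apply: le_trans (int0 r (M_ m 0)) _; apply: ereal_sup_ubound; exists 0%N.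
have IJ : (I <= C%:E * J)%E.
  apply: ge_ereal_sup => _ [L _ <-]; apply: le_trans (maxC f L mf) _.
  apply: lee_wpmul2l; first by rewrite lee_fin ltW.
  by apply: ereal_sup_ubound; exists L.
clearbody I J.
have dom (x : \bar R) : (0 <= x)%E -> x \in `[0%E, +oo%E]%R.
  by move=> x0; rewrite in_itv/= x0 leey.
have -> : ((C `^ p^-1)%:E * J `^ p^-1 = (C%:E * J) `^ p^-1)%E.
  by rewrite poweRM ?lee_fin ?(ltW C0)// poweR_EFin.
apply: gt0_ler_poweR IJ; rewrite ?invr_ge0 ?(ltW p0)//; apply: dom => //.
by rewrite mule_ge0// lee_fin ltW.
Qed.
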